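(* Let $1\le k\le n$, $x=(x',x'')\in\mathbb{R}^k\times\mathbb{R}^{n-k}$, $R>0$, $1<p<\infty$, $\alpha,\beta\in\mathbb{R}$, and let $\Omega_R=\{x\in\mathbb{R}^n:0<|x'|_k<R\}$. Write $L(x)=\log\frac{R}{|x'|_k}$. (i) If $(k-\alpha-p)(\beta+p)\ge0$, then for all complex-valued $f\in C_0^\infty(\Omega_R)$, $$\left|\frac{\beta+p}{p}\right|^p\int_{\Omega_R}\frac{|f|^p}{|x'|_k^{\alpha+p}L^{\beta+p+1}}dx\le\int_{\Omega_R}\frac{|x'\cdot\nabla_kf|^p}{|x'|_k^{\alpha+p}L^{\beta+1}}dx,$$ and when $\beta\ne-p$ the constant $\left|\frac{\beta+p}{p}\right|^p$ is sharp (it cannot be replaced by any larger constant). (ii) For all complex-valued $f\in C_0^\infty(\Omega_R)$, $$\left|\frac{\beta+p}{p}\right|^p\int_{\Omega_R}\frac{|f|^p}{|x'|_k^{\alpha+p}L^{\beta+p+1}}dx=\int_{\Omega_R}\frac{|x'\cdot\nabla_kf|^p}{|x'|_k^{\alpha+p}L^{\beta+1}}dx-(k-\alpha-p)\frac{\beta+p}{p}\left|\frac{\beta+p}{p}\right|^{p-2}\int_{\Omega_R}\frac{|f|^p}{|x'|_k^{\alpha+p}L^{\beta+p}}dx-\int_{\Omega_R}C_p(\xi,\eta)\,dx,$$ where $\xi=\dfrac{x'\cdot\nabla_kf}{|x'|_k^{(\alpha+p)/p}L^{(\beta+1)/p}}$ and $\eta=\xi+\dfrac{\beta+p}{p}\,\dfrac{f}{|x'|_k^{(\alpha+p)/p}L^{(\beta+p+1)/p}}$.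 (iii) If $k=\alpha+p$ and $p\ge2$, then $\int_{\Omega_R}C_p(\xi,\eta)dx$ vanishes only if $f=L^{(\beta+p)/p}\varphi(x'/|x'|_k,x'')$ for some function $\varphi$, which for $f\in C_0^\infty(\Omega_R)$ forces $f=0$; hence the inequality in (i) is strict for every nonzero $f\in C_0^\infty(\Omega_R)$ (the sharp constant is not attained).
   Context: $|\cdot|_k$ is the Euclidean norm on $\mathbb{R}^k$, $\nabla_k=(\partial_{x_1},\dots,\partial_{x_k})$, $x'\cdot\nabla_kf=\sum_{j=1}^kx_j\partial_{x_j}f$. For complex $\xi,\eta$ and $1<p<\infty$, $C_p(\xi,\eta):=|\xi|^p-|\xi-\eta|^p-p|\xi-\eta|^{p-2}\operatorname{Re}((\xi-\eta)\overline{\eta})$, with the last term $0$ when $\xi=\eta$. *)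

(* Defs.v *)
(* mathcomp-analysis (realType R, Lebesgue measure on R,
   directional derivatives `derive`), complex numbers R[i] from real_closed. *)
From HB Require Import structures.
From mathcomp Require Import all_boot all_order all_algebra.
From mathcomp Require Import all_classical all_reals all_analysis.
From mathcomp Require Import complex.

Set Implicit Arguments.
Unset Strict Implicit.
Unset Printing Implicit Defensive.

Import Order.TTheory GRing.Theory Num.Theory.
Import numFieldNormedType.Exports.

Local Open Scope classical_set_scope.
Local Open Scope ring_scope.

(* Euclidean norm |v|_k on R^k (row vectors). *)
Definition enorm (R : realType) (k : nat) (v : 'rV[R]_k) : R :=
  Num.sqrt (\sum_(j < k) v ord0 j ^+ 2).

(* Points of R^n with n = k + m are written x = (x', x'') with
   x' = lsubmx x in R^k and x'' = rsubmx x in R^m. *)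

(* Omega_R = { x : 0 < |x'|_k < r } *)
Definition OmegaR (R : realType) (k m : nat) (r : R) : set 'rV[R]_(k + m) :=
  [set x | 0 < enorm (lsubmx x) < r].

(* L(x) = log (r / |x'|_k) *)
Definition logRx (R : realType) (k m : nat) (r : R) (x : 'rV[R]_(k + m)) : R :=
  ln (r / enorm (lsubmx x)).

(* iterated directional derivatives D_{v1} D_{v2} ... D_{vj} f *)
Fixpoint iderive (R : realType) (N : nat) (vs : seq 'rV[R]_N)
    (f : 'rV[R]_N -> R) : 'rV[R]_N -> R :=
  match vs with
  | [::] => f
  | v :: vs' => fun x => derive (iderive vs' f) x v
  end.

(* C^infinity on R^N: all iterated directional derivatives exist everywhere
   and are continuous. *)
Definition smooth (R : realType) (N : nat) (f : 'rV[R]_N -> R) : Prop :=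
  forall vs : seq 'rV[R]_N,
    continuous (iderive vs f) /\ (forall x v, derivable (iderive vs f) x v).

(* compact support contained in D *)
Definition compact_support_in (R : realType) (N : nat) (T : Type) (z : T)
    (D : set 'rV[R]_N) (f : 'rV[R]_N -> T) : Prop :=
  exists K : set 'rV[R]_N, compact K /\ K `<=` D /\ (forall x, ~ K x -> f x = z).

(* complex-valued C_0^infinity(D): real and imaginary parts smooth, and
   compact support inside D *)
Definition C0inf (R : realType) (N : nat) (D : set 'rV[R]_N)
    (f : 'rV[R]_N -> R[i]) : Prop :=
  smooth (fun x => complex.Re (f x)) /\ smooth (fun x => complex.Im (f x)) /\
  compact_support_in 0 D f.

(* partial derivative d f / d x_i (complex-valued, componentwise) *)
Definition cpartial (R : realType) (N : nat) (f : 'rV[R]_N -> R[i])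
    (i : 'I_N) (x : 'rV[R]_N) : R[i] :=
  (derive (fun y => complex.Re (f y)) x (delta_mx 0 i)
   +i* derive (fun y => complex.Im (f y)) x (delta_mx 0 i))%C.

(* x' . nabla_k f = sum_{j<k} x_j d_{x_j} f *)
Definition xgrad (R : realType) (k m : nat) (f : 'rV[R]_(k + m) -> R[i])
    (x : 'rV[R]_(k + m)) : R[i] :=
  \sum_(j < k) (x ord0 (lshift m j))%:C%C * cpartial f (lshift m j) x.

(* modulus of a complex number *)
Definition cabs (R : realType) (z : R[i]) : R :=
  Num.sqrt (complex.Re z ^+ 2 + complex.Im z ^+ 2).

(* C_p(xi, eta) *)
Definition Cp (R : realType) (p : R) (xi eta : R[i]) : R :=
  if xi == eta then cabs xi `^ p
  else cabs xi `^ p - cabs (xi - eta) `^ p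
       - p * cabs (xi - eta) `^ (p - 2) * complex.Re ((xi - eta) * eta^*)%C.

(* Lebesgue integral over R^N, as the iterated integral of one-dimensional
   Lebesgue integrals (all integrands used below are non-negative, so by
   Tonelli this is the Lebesgue integral on R^N). *)
Fixpoint iint (R : realType) (N : nat) : ('rV[R]_N -> \bar R) -> \bar R :=
  match N with
  | 0 => fun f => f 0
  | N'.+1 => fun f =>
      (\int[lebesgue_measure]_t iint (fun y => f (row_mx (\row_(_ < 1) t) y)))%E
  end.

(* integral over a subset D of R^N *)
Definition integral_on (R : realType) (N : nat) (D : set 'rV[R]_N)
    (g : 'rV[R]_N -> \bar R) : \bar R :=
  iint (fun x => if `[< D x >] then g x else 0%E).

(* xi = x'.nabla_k f / (|x'|^((alpha+p)/p) L^((beta+1)/p)) *)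
Definition xi_fun (R : realType) (k m : nat) (r p alpha beta : R)
    (f : 'rV[R]_(k + m) -> R[i]) (x : 'rV[R]_(k + m)) : R[i] :=
  ((enorm (lsubmx x) `^ ((alpha + p) / p) * logRx r x `^ ((beta + 1) / p))^-1)%:C%C
  * xgrad f x.

(* eta = xi + (beta+p)/p * f / (|x'|^((alpha+p)/p) L^((beta+p+1)/p)) *)
Definition eta_fun (R : realType) (k m : nat) (r p alpha beta : R)
    (f : 'rV[R]_(k + m) -> R[i]) (x : 'rV[R]_(k + m)) : R[i] :=
  xi_fun r p alpha beta f x
  + (((beta + p) / p) /
      (enorm (lsubmx x) `^ ((alpha + p) / p) * logRx r x `^ ((beta + p + 1) / p)))%:C%C
    * f x.

(* Main.v *)
Require Import Defs.
From HB Require Import structures.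
From mathcomp Require Import all_boot all_order all_algebra.
From mathcomp Require Import all_classical all_reals all_analysis.
From mathcomp Require Import complex ring lra.
Import Order.TTheory GRing.Theory Num.Theory.
Import numFieldNormedType.Exports.
Local Open Scope classical_set_scope.
Local Open Scope ring_scope.

Set Implicit Arguments.
Unset Strict Implicit.
Unset Printing Implicit Defensive.

(* Writing [E f = x' . grad_k f], the divergence theorem applied to the field
   [|f|^p |x'|^-a L^-b x'] gives, since [E |x'| = |x'|] and [E L = -1],
     (k - a) int |f|^p |x'|^-a L^-b + b int |f|^p |x'|^-a L^(-b-1)
       + p int |f|^(p-2) Re (f conj(E f)) |x'|^-a L^-b = 0.
   With [a = alpha + p] and [b = beta + p], expanding [C_p] pointwise turns this into (ii), and
   (i) follows since [C_p >= 0] by Young's inequality.  In (iii), [C_p = 0] forces [eta = 0],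
   that is [E f = - ((beta + p) / p) f / L], and the same identity with [b = beta + p + 1] gives
   [f = 0].  For the sharpness, test with
   [f = L^((beta + p) / p) G(e log L + 1) h(x'')] for a bump function [G] on [0, 1] and small
   [e]: the error involves only [e^p int |G'|^p], and the divergence theorem also shows that
   the ratio of the integrals of [|G'|^p] and [|G|^p] (as functions of [e log L + 1], against
   [|x'|^-k L^-1 h^p dx]) is the one-dimensional ratio, hence independent of [e].
   The divergence theorem for the iterated integral is obtained from translation invariance
   alone, so that neither Fubini nor polar coordinates are needed. *)

(** * Continuous functions of compact support *)

(** The weights are singular at |x'| = 0 and at |x'| = R, but every density lives on a compact
    subset of the open cylinder. Extended by zero it is continuous with compact support, and in this
    class finiteness, linearity, translation invariance and the vanishing of nonnegative functions
    of zero integral are elementary. The power [b = beta + p] is forced: the cross term of [C_p]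
    carries exactly the weight |x'|^-(alpha + p) L^-(beta + p). For sharpness, the virtual extremal
    L^((beta + p) / p) makes the two integrands of (i) proportional with ratio |(beta + p) / p|^p,
    both being multiples of |x'|^-(alpha + p) L^-1, whose integral diverges logarithmically at L =
    0. A cut-off in the variable log L, stretched by 1/e, therefore costs only a factor e per
    derivative. The one-dimensional ratio is exact only for the weight |x'|^-k, but the cut-off sits
    in L < 1, that is |x'| > R exp(-1), where |x'|^-k and |x'|^-(alpha + p) are comparable with
    constants independent of e. The comparison touches only the error term, so these constants do no
    harm. *)

Definition Cc (R : realType) (V : normedModType R) (g : V -> R) :=
  continuous g /\ exists M : R, forall x, M < `|x| -> g x = 0.

Lemma Cc_bound_pos (R : realType) (V : normedModType R) (g : V -> R) :
  Cc g -> exists2 M : R, 0 < M & forall x, M <= `|x| -> g x = 0.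
Proof.
move=> [_ [M HM]]; exists (`|M| + 1) => [|x Mx]; first by rewrite ltr_wpDl.
apply: HM; apply: le_lt_trans (ler_norm M) _.
by apply: lt_le_trans Mx; rewrite ltrDl.
Qed.

Lemma CcD (R : realType) (V : normedModType R) (f g : V -> R) :
  Cc f -> Cc g -> Cc (fun x => f x + g x).
Proof.
move=> [cf [M HM]] [cg [M' HM']]; split.
  by move=> x; apply: cvgD; [exact: cf|exact: cg].
exists (Num.max M M') => x; rewrite gt_max => /andP[h1 h2].
by rewrite HM// HM'// addr0.
Qed.

Lemma CcMl (R : realType) (V : normedModType R) (f g : V -> R) :
  continuous f -> Cc g -> Cc (fun x => f x * g x).
Proof.
move=> cf [cg [M HM]]; split.
  by move=> x; apply: cvgM; [exact: cf|exact: cg].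
by exists M => x Mx; rewrite HM// mulr0.
Qed.

Lemma CcZ (R : realType) (V : normedModType R) (a : R) (g : V -> R) :
  Cc g -> Cc (fun x => a * g x).
Proof. by apply: CcMl; move=> x; apply: cvg_cst. Qed.

Lemma Cc0 (R : realType) (V : normedModType R) : Cc (fun _ : V => 0 : R).
Proof. by split; [move=> x; exact: cvg_cst|exists 0]. Qed.

Lemma Cc_sum (R : realType) (V : normedModType R) (n : nat) (g : 'I_n -> V -> R) :
  (forall i, Cc (g i)) -> Cc (fun x => \sum_(i < n) g i x).
Proof.
elim: n g => [|n IH] g Hg.
  by under [X in Cc X]eq_fun do rewrite big_ord0; exact: Cc0.
under [X in Cc X]eq_fun do rewrite big_ord_recl.
by apply: CcD => //; apply: IH.
Qed.

Lemma Cc_shift (R : realType) (V : normedModType R) (g : V -> R) (v : V) :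
  Cc g -> Cc (fun x => g (x + v)).
Proof.
move=> [cg [M HM]]; split.
  move=> x; apply: (@continuous_comp _ _ _ (fun x => x + v) g); last exact: cg.
  by apply: cvgD; [exact: cvg_id|exact: cvg_cst].
exists (M + `|v|) => x Mx; apply: HM.
rewrite -(ltrD2r `|v|); apply: lt_le_trans Mx _.
by rewrite -{1}(addrK v x); apply: ler_normB.
Qed.

(** * Integrals over the line *)

Section OneDim.
Variable R : realType.
Local Notation mu := (@lebesgue_measure R).

Lemma Cc_restrict (f : R -> R) (M : R) :
  (forall x, M < `|x| -> f x = 0) -> f \_ `[- M, M] = f.
Proof.
move=> HM; apply/funext => x; rewrite patchE; case: ifPn => // /negP xM.
apply/esym/HM; rewrite ltNge; apply/negP => h; apply: xM.
by rewrite inE /= in_itv /= -ler_norml.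
Qed.

Lemma Cc_integrable (f : R -> R) : Cc f -> mu.-integrable setT (EFin \o f).
Proof.
move=> [cf [M HM]]; rewrite -(Cc_restrict HM) -restrict_EFin.
apply: (iffLR (integrable_mkcond _ _)) => //.
apply: continuous_compact_integrable; first exact: segment_compact.
exact: continuous_subspaceT.
Qed.

Lemma Rint_bound (f : R -> R) (M e : R) : 0 <= M -> Cc f ->
  (forall x, M < `|x| -> f x = 0) -> (forall x, `|f x| <= e) ->
  `|\int[mu]_x f x| <= e * (2 * M).
Proof.
move=> M0 cf HM fe.
apply: le_trans; first by apply: le_normr_Rintegral => //; exact: Cc_integrable.
have -> : e * (2 * M) = \int[mu]_(x in `[- M, M]) e.
  rewrite Rintegral_cst//= lebesgue_measure_itv/= lte_fin.
  case: ltP => h /=; first by lra.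
  by rewrite (_ : M = 0) ?mulr0 ?mul0r ?mulr0 //; lra.
rewrite -(@Cc_restrict (fun x => `|f x|) M); last first.
  by move=> x /HM ->; rewrite normr0.
rewrite -Rintegral_mkcond; apply: le_Rintegral => //.
- apply: continuous_compact_integrable; first exact: segment_compact.
  apply: continuous_subspaceT => x.
  by apply: (@continuous_comp _ _ _ f Num.norm); [exact: cf.1|exact: norm_continuous].
- apply: continuous_compact_integrable; first exact: segment_compact.
  by apply: continuous_subspaceT => x; exact: cvg_cst.
Qed.

Lemma Rint_shift (f : R -> R) (h : R) : Cc f ->
  \int[mu]_x f (x + h) = \int[mu]_x f x.
Proof.
move=> cf; have [M M0 HM] := Cc_bound_pos cf.
(* Widening by [|h|] on both sides makes [[a, b]] contain the support of the translate and
   [[a + h, b + h]] that of [f], so the substitution rule on bounded intervals suffices. *)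
pose a := - M - `|h|; pose b := M + `|h|.
have ab : a <= b by rewrite /a /b; have := normr_ge0 h; lra.
have dF : derive1 (fun x : R => x + h) = cst 1.
  by apply/funext => x; rewrite derive1E; exact: (congr1 (@^~ x) (derive_shift 1 h)).
have := @integration_by_substitution_increasing R (fun x => x + h) f a b ab.
rewrite dF => /(_ _ _ _ _ _ _) H.
have {}H : \int[mu]_(x in `[a + h, b + h]) f x = \int[mu]_(x in `[a, b]) f (x + h).
  rewrite /Rintegral H.
  - by congr fine; apply: eq_integral => x _ /=; rewrite /GRing.mul /= mulr1.
  - by move=> x y _ _ xy; rewrite ltrD2r.
  - by move=> x _; exact: cvg_cst.
  - by apply: is_cvg_cst.
  - by apply: is_cvg_cst.
  - split.
    + by move=> x _; apply: derivableD => //; exact: derivable_cst.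
    + apply: cvg_at_right_filter; apply: cvgD; [exact: cvg_id|exact: cvg_cst].
    + apply: cvg_at_left_filter; apply: cvgD; [exact: cvg_id|exact: cvg_cst].
  - by apply: continuous_subspaceT; exact: cf.1.
have E1 : f \_ `[a + h, b + h] = f.
  apply/funext => x; rewrite patchE; case: ifPn => // /negP xM.
  apply/esym/HM; rewrite leNgt; apply/negP => xl; apply: xM.
  rewrite inE /= in_itv /= /a /b; move: xl; rewrite ltr_norml.
  by have := ler_norm h; have := ler_norm (- h); rewrite normrN; lra.
have E2 : (fun x => f (x + h)) \_ `[a, b] = (fun x => f (x + h)).
  apply/funext => x; rewrite patchE; case: ifPn => // /negP xM.
  apply/esym/HM; rewrite leNgt; apply/negP => xl; apply: xM.
  rewrite inE /= in_itv /= /a /b; move: xl; rewrite ltr_norml.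
  by have := ler_norm h; have := ler_norm (- h); rewrite normrN; lra.
by move: H; rewrite Rintegral_mkcond E1 => ->; rewrite [RHS]Rintegral_mkcond E2.
Qed.

Lemma Rint_eq0 (f : R -> R) : Cc f -> (forall x, 0 <= f x) ->
  \int[mu]_x f x = 0 -> forall x, f x = 0.
Proof.
move=> cf f0 I0 x; apply/eqP; rewrite -[_ == _]negbK; apply/negP => fx0.
have fx : 0 < f x by rewrite lt_neqAle eq_sym fx0 f0.
have : \forall y \near x, f x / 2 < f y.
  by apply: (cvgr_gt (f x) (cf.1 x)); lra.
move=> /nbhs_ballP[d /= d0 Hd].
pose A := `[x - d / 2, x + d / 2]%classic.
have mA : measurable (A : set (measurableTypeR R)) by exact: measurable_itv.
have : \int[mu]_(y in A) (f x / 2) <= \int[mu]_(y in A) f y.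
  apply: le_Rintegral => //.
  - apply: continuous_compact_integrable; first exact: segment_compact.
    by apply: continuous_subspaceT => y; exact: cvg_cst.
  - by apply: integrableS (Cc_integrable cf).
  - move=> y; rewrite /A /= in_itv /= => yA; apply/ltW/Hd.
    by rewrite /ball /= ltr_norml; lra.
rewrite Rintegral_cst//= lebesgue_measure_itv/= lte_fin ifT; last by lra.
rewrite /= => H1.
have : \int[mu]_(y in A) f y <= \int[mu]_y f y.
  rewrite Rintegral_mkcond; apply: le_Rintegral => //.
  - rewrite -restrict_EFin; apply: (iffLR (integrable_mkcond _ _)) => //.
    by apply: integrableS (Cc_integrable cf).
  - exact: Cc_integrable.
  - by move=> y _; rewrite patchE; case: ifP.
rewrite I0 => H2; have := le_trans H1 H2.
have : 0 < f x * d by exact: mulr_gt0.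
by nra.
Qed.
End OneDim.

(** * Iterated integrals of continuous functions *)

Section RowVectors.
Variable R : realType.

Lemma mx_norm_leP (m n : nat) (x : 'M[R]_(m, n)) (e : R) : 0 <= e ->
  (forall i j, `|x i j| <= e) <-> `|x| <= e.
Proof.
move=> e0; rewrite [`|x|]mx_normrE; split.
  by move=> H; apply/bigmax_leP; split => // -[i j] _ /=; exact: H.
by move=> /bigmax_leP[_ H] i j; exact: (H (i, j)).
Qed.

Lemma coord_le_norm (m n : nat) (x : 'M[R]_(m, n)) i j : `|x i j| <= `|x|.
Proof. by have [_ H] := mx_norm_leP x (normr_ge0 x); exact: H. Qed.

(** The point at which [iint] evaluates its integrand, typed in [N.+1] rather than [1 + N]; hence
    the explicit [n1 := 1] in the rewrites below. *)
Definition consr (N : nat) (t : R) (y : 'rV[R]_N) : 'rV[R]_(N.+1) :=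
  row_mx (\row_(_ < 1) t) y.

Lemma consr_norm (N : nat) (t : R) (y : 'rV[R]_N) :
  `|consr t y| = Num.max `|t| `|y|.
Proof.
apply/eqP; rewrite eq_le; apply/andP; split.
  have H0 : 0 <= Num.max `|t| `|y| by rewrite le_max normr_ge0.
  apply/(mx_norm_leP _ H0) => i j; rewrite /consr le_max ord1.
  rewrite -(splitK (m:=1) j) /=; case: (fintype.split (m:=1) j) => j' /=.
    by rewrite (row_mxEl (n1:=1)) mxE lexx.
  by rewrite (row_mxEr (n1:=1)) coord_le_norm orbT.
rewrite ge_max; apply/andP; split.
  have := coord_le_norm (consr t y) 0 (lshift N (0 : 'I_1)).
  by rewrite /consr (row_mxEl (n1:=1)) mxE.
apply/(mx_norm_leP _ (normr_ge0 _)) => i j; rewrite ord1.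
have := coord_le_norm (consr t y) 0 (rshift 1 j).
by rewrite /consr (row_mxEr (n1:=1)).
Qed.

Lemma consrD (N : nat) (t s : R) (y z : 'rV[R]_N) :
  consr (t + s) (y + z) = consr t y + consr s z.
Proof.
rewrite /consr (add_row_mx (n1:=1)); apply: (congr2 (@row_mx R 1 1 N)) => //.
by apply/rowP => i; rewrite !mxE.
Qed.

Lemma consrZ (N : nat) (t s : R) (y : 'rV[R]_N) :
  consr (s * t) (s *: y) = s *: consr t y.
Proof.
rewrite /consr (scale_row_mx (n1:=1)); apply: (congr2 (@row_mx R 1 1 N)) => //.
by apply/rowP => i; rewrite !mxE.
Qed.

Lemma consr_continuous (N : nat) :
  continuous (fun ty : R * 'rV[R]_N => consr ty.1 ty.2).
Proof.
move=> [t y]; apply/cvgrPdist_lt => e e0; near=> p.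
rewrite [X in X - _]/= -[- consr _ _]scaleN1r -consrZ -consrD consr_norm gt_max.
rewrite !mulN1r !scaleN1r; apply/andP; split; near: p.
  by apply: cvgr_dist_lt => //; exact: cvg_fst.
by apply: cvgr_dist_lt => //; exact: cvg_snd.
Unshelve. all: by end_near. Qed.

Lemma consr_eta (N : nat) (x : 'rV[R]_N.+1) :
  exists t y, x = consr t y.
Proof.
exists (x 0 (lshift N (0 : 'I_1))), (\row_j x 0 (rshift 1 j)).
apply/rowP => j; rewrite /consr -(splitK (m:=1) j) /=.
case: (fintype.split (m:=1) j) => j' /=.
  by rewrite (row_mxEl (n1:=1)) mxE; rewrite (ord1 j').
by rewrite (row_mxEr (n1:=1)) mxE.
Qed.

Lemma Cc_slice (N : nat) (g : 'rV[R]_N.+1 -> R) (t : R) :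
  Cc g -> Cc (fun y => g (consr t y)).
Proof.
move=> [cg [M HM]]; split; last first.
  by exists M => y My; apply: HM; rewrite consr_norm lt_max My orbT.
move=> y; apply: (@continuous_comp _ _ _ (fun y => consr t y) g); last exact: cg.
apply: (@continuous_comp _ _ _ (fun y => (t, y)) (fun ty => consr ty.1 ty.2)).
  by apply: (@cvg_pair _ _ _ (nbhs y) (nbhs t) (nbhs y)); [exact: cvg_cst|exact: cvg_id].
exact: consr_continuous.
Qed.

(** Joint continuity gives a product neighbourhood of each [(i0, x)] on which [phi] varies by less
    than e/2, and compactness merges these into one neighbourhood of [i0]. Both exchanges of a limit
    with an integral, for slices and for difference quotients, rest on this. *)
Lemma compact_unif (I X : topologicalType) (K : set X) (phi : I -> X -> R)
    (i0 : I) (e : R) : compact K -> 0 < e ->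
  (forall x, K x -> {for (i0, x), continuous (fun p => phi p.1 p.2)}) ->
  \forall i \near i0, forall x, K x -> `|phi i x - phi i0 x| < e.
Proof.
move=> /compact_near_coveringP cK e0 cphi.
apply: (cK I (nbhs i0) (fun i x => `|phi i x - phi i0 x| < e)) => x Kx.
have e20 : 0 < e / 2 by lra.
have /cvgrPdist_lt/(_ _ e20)/= [[A B] /= [HA HB] AB] := cphi x Kx.
exists (B, A) => //= -[x' i] /= [Bx Ai].
have h1 := AB (i, x') (conj Ai Bx).
have h2 := AB (i0, x') (conj (nbhs_singleton HA) Bx).
move: h1 h2 => /=; rewrite !ltr_norml; lra.
Qed.

Lemma closed_ball_compact (N : nat) (M : R) : compact [set x : 'rV[R]_N | `|x| <= M].
Proof.
apply: bounded_closed_compact.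
  by exists M; split; [exact: num_real|move=> y My x /= xM; exact/ltW/(le_lt_trans xM)].
refine (@preimage_closed 'rV[R]_N R Num.norm [set r : R | r <= M] _ (@closed_le R M)).
by move=> x _; exact: norm_continuous.
Qed.

End RowVectors.

Section IteratedIntegral.
Variable R : realType.
Local Notation mu := (@lebesgue_measure R).

(** Real-valued counterpart of [iint]. The two agree on [Cc] functions ([iint_rint]), so the whole
    argument can be carried out in R without infinite values. *)
Fixpoint rint (N : nat) : ('rV[R]_N -> R) -> R :=
  match N with
  | 0 => fun f => f 0
  | N'.+1 => fun f => \int[mu]_t rint (fun y => f (consr t y))
  end.

(** The first two premises are linearity and the size bound in dimension N, assumed here because the
    induction in [rint_props] needs continuity of slices to reach dimension N + 1. Two nearby slices
    differ by a uniformly small function supported in a fixed ball, which the size bound makes small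
    after integration. *)
Lemma rint_slice_Cc (N : nat) (g : 'rV[R]_N.+1 -> R) :
  (forall (a : R) (f h : 'rV[R]_N -> R), Cc f -> Cc h ->
    rint (fun x => a * f x + h x) = a * rint f + rint h) ->
  (forall (f : 'rV[R]_N -> R) (M e : R), 0 <= M -> Cc f ->
    (forall x, M < `|x| -> f x = 0) -> (forall x, `|f x| <= e) ->
    `|rint f| <= e * (2 * M) ^+ N) ->
  Cc g -> Cc (fun t => rint (fun y => g (consr t y))).
Proof.
move=> lin bnd cg; have [M M0 HM] := Cc_bound_pos cg.
have supp t y : M < `|y| -> g (consr t y) = 0.
  by move=> My; apply: HM; rewrite consr_norm le_max (ltW My) orbT.
split; last first.
  exists M => t Mt.
  have E0 : rint (fun _ : 'rV[R]_N => 0) = 0.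
    have := lin (-1) (fun=> 0) (fun=> 0) (Cc0 _) (Cc0 _).
    by rewrite mulr0 addr0; lra.
  rewrite -[RHS]E0; congr rint; apply/funext => y; apply: HM.
  by rewrite consr_norm le_max (ltW Mt).
move=> t0; apply/cvgrPdist_lt => e e0.
pose d := e / ((2 * M) ^+ N + 1).
have P0 : 0 < (2 * M) ^+ N by apply: exprn_gt0; lra.
have d0 : 0 < d by apply: divr_gt0 => //; lra.
have := @compact_unif R R 'rV[R]_N _ (fun t y => g (consr t y)) t0 d
  (@closed_ball_compact R N M) d0.
case=> [x _|].
  apply: (@continuous_comp _ _ _ (fun ty => consr ty.1 ty.2) g); last exact: cg.1.
  exact: consr_continuous.
move=> eps /= eps0 H; exists eps => //= t tt.
have -> : rint (fun y => g (consr t0 y)) - rint (fun y => g (consr t y)) =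
  rint (fun y => -1 * g (consr t y) + g (consr t0 y)).
  rewrite lin; [by rewrite mulN1r addrC| |]; exact: Cc_slice.
have h : `|rint (fun y => -1 * g (consr t y) + g (consr t0 y))| <= d * (2 * M) ^+ N.
  apply: bnd; first exact: ltW.
  - by apply: CcD; [apply: CcZ|]; exact: Cc_slice.
  - by move=> x Mx; rewrite !supp// mulr0 addr0.
  - move=> x; case: (leP `|x| M) => xM.
      by rewrite mulN1r -normrN opprD opprK; apply/ltW/H.
    by rewrite !supp// mulr0 addr0 normr0 ltW.
apply: le_lt_trans h _.
by rewrite /d mulrAC ltr_pdivrMr ?ltr_pM2l ?ltrDl//; lra.
Qed.

(** The norm on row vectors is the sup norm, so [(2 * M) ^+ N] is the volume of the ball of radius
    M. *)
Lemma rint_props (N : nat) :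
  (forall (a : R) (f h : 'rV[R]_N -> R), Cc f -> Cc h ->
    rint (fun x => a * f x + h x) = a * rint f + rint h) /\
  (forall (f : 'rV[R]_N -> R) (M e : R), 0 <= M -> Cc f ->
    (forall x, M < `|x| -> f x = 0) -> (forall x, `|f x| <= e) ->
    `|rint f| <= e * (2 * M) ^+ N).
Proof.
elim: N => [|N [lin bnd]]; first by split => // f M e M0 _ _ fe; rewrite expr0 mulr1; exact: fe.
split=> [a f h cf ch|f M e M0 cf fM fe] /=.
  rewrite -RintegralZl//; last by apply: Cc_integrable; exact: rint_slice_Cc.
  rewrite -RintegralD//.
  - by apply: eq_Rintegral => t _; rewrite lin//; exact: Cc_slice.
  - by apply: Cc_integrable; apply: CcZ; exact: rint_slice_Cc.
  - by apply: Cc_integrable; exact: rint_slice_Cc.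
rewrite exprSr mulrA; apply: Rint_bound => //.
- exact: rint_slice_Cc.
- move=> t tM.
  have E0 : rint (fun _ : 'rV[R]_N => 0) = 0.
    have := lin (-1) (fun=> 0) (fun=> 0) (Cc0 _) (Cc0 _).
    by rewrite mulr0 addr0; lra.
  rewrite -[RHS]E0; congr rint; apply/funext => y; apply: fM.
  by rewrite consr_norm lt_max tM.
- move=> t; apply: bnd => // [|x Mx]; first exact: Cc_slice.
  by apply: fM; rewrite consr_norm lt_max Mx orbT.
Qed.

Lemma Cc_rint_slice (N : nat) (g : 'rV[R]_N.+1 -> R) :
  Cc g -> Cc (fun t => rint (fun y => g (consr t y))).
Proof. have [? ?] := rint_props N; exact: rint_slice_Cc. Qed.

Lemma rint_lin (N : nat) (a : R) (f h : 'rV[R]_N -> R) : Cc f -> Cc h ->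
  rint (fun x => a * f x + h x) = a * rint f + rint h.
Proof. exact: (rint_props N).1. Qed.

Lemma rint_bound (N : nat) (f : 'rV[R]_N -> R) (M e : R) : 0 <= M -> Cc f ->
    (forall x, M < `|x| -> f x = 0) -> (forall x, `|f x| <= e) ->
    `|rint f| <= e * (2 * M) ^+ N.
Proof. exact: (rint_props N).2. Qed.

Lemma rint0 (N : nat) : rint (fun _ : 'rV[R]_N => 0) = 0.
Proof.
have := @rint_lin N (-1) (fun=> 0) (fun=> 0) (Cc0 _) (Cc0 _).
rewrite mulr0 addr0; lra.
Qed.

Lemma rintZ (N : nat) (a : R) (f : 'rV[R]_N -> R) : Cc f ->
  rint (fun x => a * f x) = a * rint f.
Proof.
move=> cf; rewrite -[RHS]addr0 -(rint0 N) -rint_lin//; last exact: Cc0.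
by congr rint; apply/funext => x; rewrite addr0.
Qed.

Lemma rintD (N : nat) (f h : 'rV[R]_N -> R) : Cc f -> Cc h ->
  rint (fun x => f x + h x) = rint f + rint h.
Proof.
move=> cf ch; rewrite -[rint f]mul1r -rint_lin//.
by congr rint; apply/funext => x; rewrite mul1r.
Qed.

Lemma rint_sum (N n : nat) (g : 'I_n -> 'rV[R]_N -> R) :
  (forall i, Cc (g i)) ->
  rint (fun x => \sum_(i < n) g i x) = \sum_(i < n) rint (g i).
Proof.
elim: n g => [|n IH] g Hg.
  by rewrite big_ord0 -[RHS](rint0 N); congr rint; apply/funext => x; rewrite big_ord0.
rewrite big_ord_recl -IH// -rintD//; last exact: Cc_sum.
by congr rint; apply/funext => x; rewrite big_ord_recl.
Qed.

Lemma rint_ge0 (N : nat) (f : 'rV[R]_N -> R) : (forall x, 0 <= f x) -> 0 <= rint f.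
Proof.
elim: N f => [|N IH] f f0 /=; first exact: f0.
by apply: Rintegral_ge0 => t _; apply: IH.
Qed.

Lemma le_rint (N : nat) (f h : 'rV[R]_N -> R) : Cc f -> Cc h ->
  (forall x, f x <= h x) -> rint f <= rint h.
Proof.
move=> cf ch fh; rewrite -subr_ge0.
have -> : rint h - rint f = rint (fun x => -1 * f x + h x).
  by rewrite rint_lin// mulN1r addrC.
by apply: rint_ge0 => x; rewrite mulN1r addrC subr_ge0.
Qed.

Lemma rint_eq0 (N : nat) (f : 'rV[R]_N -> R) : Cc f -> (forall x, 0 <= f x) ->
  rint f = 0 -> forall x, f x = 0.
Proof.
elim: N f => [|N IH] f cf f0 /= If x; first by rewrite (_ : x = 0)//; apply/rowP => -[].
have [t [y ->]] := consr_eta x.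
apply: (IH (fun y => f (consr t y))) => //; first exact: Cc_slice.
apply: (Rint_eq0 (Cc_rint_slice cf)) => // s.
by apply: rint_ge0.
Qed.

(** Each coordinate is shifted under its own integral sign, so the order of integration never
    changes. *)
Lemma rint_shift (N : nat) (f : 'rV[R]_N -> R) (v : 'rV[R]_N) : Cc f ->
  rint (fun x => f (x + v)) = rint f.
Proof.
elim: N f v => [|N IH] f v cf /=.
  by rewrite (_ : 0 + v = 0)//; apply/rowP => -[].
have [s [w ->]] := consr_eta v.
under eq_Rintegral.
  move=> t _; under [X in rint X]eq_fun do rewrite -consrD.
  rewrite (IH (fun y => f (consr (t + s) y)) w); last exact: Cc_slice.
  over.
exact: (Rint_shift s (Cc_rint_slice cf)).
Qed.

Lemma iint_rint (N : nat) (f : 'rV[R]_N -> R) : Cc f ->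
  iint (fun x => (f x)%:E) = (rint f)%:E.
Proof.
elim: N f => [|N IH] f cf //=.
under eq_integral => t _ do rewrite (IH (fun y => f (consr t y)) (Cc_slice t cf)).
rewrite /Rintegral fineK//.
exact/integrable_fin_num/Cc_integrable/Cc_rint_slice.
Qed.

End IteratedIntegral.

(** * Integrals of directional derivatives *)

Section DirectionalDerivatives.
Variables (R : realType) (V : normedModType R).

(** The two difference quotients are the same function of [h]. This brings the one-variable chain
    rule and mean value theorem to directional derivatives without total differentiability. *)
Lemma is_derive_line (G : V -> R) (x v : V) (s d : R) :
  is_derive s 1 (fun t : R => G (x + t *: v)) d <-> is_derive (x + s *: v) v G d.
Proof.
have E : (fun h : R => h^-1 *: (((fun t : R => G (x + t *: v)) \o shift s) (h *: (1 : R)) -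
             G (x + s *: v))) =
         (fun h : R => h^-1 *: ((G \o shift (x + s *: v)) (h *: v) - G (x + s *: v))).
  apply/funext => h; rewrite /= !/shift /=; congr (_ *: (G _ - _)).
  by rewrite -[h *: (1 : R)]/(h * 1) mulr1 scalerDl addrCA.
by split=> -[D1 D2]; split; move: D1 D2; rewrite /derivable /derive E.
Qed.

Lemma is_derive_comp_dir (phi : R -> R) (G : V -> R) (x v : V) (a b : R) :
  is_derive (G x) 1 phi a -> is_derive x v G b -> is_derive x v (phi \o G) (a * b).
Proof.
move=> Hphi HG; have x0 : x = x + (0 : R) *: v by rewrite scale0r addr0.
rewrite x0; apply/(is_derive_line (phi \o G)).
apply: (@is_derive1_comp R phi (fun t : R => G (x + t *: v))).
  by rewrite -x0.
by apply/is_derive_line; rewrite -x0.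
Qed.

Lemma is_derive_uniq (G : V -> R) (x v : V) (a b : R) :
  is_derive x v G a -> is_derive x v G b -> a = b.
Proof. by move=> Ha Hb; rewrite -(@derive_val _ _ _ _ _ _ _ Ha) (@derive_val _ _ _ _ _ _ _ Hb). Qed.

End DirectionalDerivatives.

Lemma is_derive_coord (R : realType) (N : nat) (x v : 'rV[R]_N) (j : 'I_N) :
  is_derive x v (fun y : 'rV[R]_N => y ord0 j) (v ord0 j).
Proof.
have x0 : x = x + (0 : R) *: v by rewrite scale0r addr0.
rewrite x0; apply/(is_derive_line (fun y : 'rV[R]_N => y ord0 j)).
rewrite (_ : (fun t => _) = (fun t : R => x ord0 j + v ord0 j * t)); last first.
  by apply/funext => t; rewrite !mxE mulrC.
apply: is_derive_eq.
by rewrite add0r mul1r; exact: mulr1.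
Qed.

(* Translation invariance gives [rint (G (. + h v)) = rint G]; dividing by h, the mean value
   theorem and uniform continuity of the derivative let h tend to 0. *)
Lemma rint_derive_eq0 (R : realType) (N : nat) (G dG : 'rV[R]_N -> R) (v : 'rV[R]_N) :
  Cc G -> Cc dG -> (forall x, is_derive x v G (dG x)) -> rint dG = 0.
Proof.
move=> cG cdG dGP.
have [M1 M10 HM1] := Cc_bound_pos cG; have [M2 M20 HM2] := Cc_bound_pos cdG.
(* Adding [|v|] makes [G] and [dG] vanish on the whole segment from x to x + v when |x| exceeds [M],
   so one ball serves for all the translates. *)
pose M := Num.max M1 M2 + `|v|.
have M0 : 0 <= M by rewrite addr_ge0// le_max (ltW M10).
have supp x (s : R) : 0 <= s <= 1 -> M < `|x| ->
    G (x + s *: v) = 0 /\ dG (x + s *: v) = 0.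
  move=> /andP[s0 s1] Mx.
  have h : Num.max M1 M2 < `|x + s *: v|.
    rewrite -(ltrD2r `|v|); apply: lt_le_trans Mx _.
    rewrite -{1}(addrK (s *: v) x); apply: le_trans (ler_normB _ _) _.
    by rewrite lerD2l normrZ ler_piMl// ger0_norm.
  move: h; rewrite gt_max => /andP[h1 h2].
  by rewrite HM1 ?HM2//; exact: ltW.
have key (e : R) : 0 < e -> `|rint dG| <= e * (2 * M) ^+ N.
  move=> e0.
  have := @compact_unif R R 'rV[R]_N _ (fun t y => dG (y + t *: v)) 0 e
    (@closed_ball_compact R N M) e0.
  case=> [x _|eps /= eps0 H].
    apply: (@continuous_comp _ _ _ (fun p : R * 'rV[R]_N => p.2 + p.1 *: v) dG).
      apply: cvgD; first exact: cvg_snd.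
      by apply: cvgZr_tmp; exact: cvg_fst.
    exact: cdG.1.
  pose h := Num.min (eps / 2) 1.
  have h0 : 0 < h by rewrite lt_min; apply/andP; split; lra.
  have h1 : h <= 1 by rewrite ge_min lexx orbT.
  have heps : h < eps by rewrite gt_min; apply/orP; left; lra.
  have mv x : `|G (x + h *: v) - G x - h * dG x| <= h * e.
    have dl t := (is_derive_line G x v t _).2 (dGP _).
    have cl : {within `[0, h], continuous (fun t : R => G (x + t *: v))}.
      apply: derivable_within_continuous => t _.
      exact: (@ex_derive _ _ _ _ _ _ _ (dl t)).
    have [c + +] := MVT h0 (fun t _ => dl t) cl.
    rewrite in_itv /= => /andP[c0 ch]; rewrite scale0r addr0 subr0 => ->.
    rewrite mulrC -mulrBr normrM gtr0_norm// ler_pM2l//.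
    case: (leP `|x| M) => xM.
      have := H c _ x xM; rewrite scale0r addr0 => /(_ _)/ltW; apply.
      by rewrite /ball_ /= sub0r normrN gtr0_norm//; lra.
    have [_ ->] := supp x c ltac:(lra) xM.
    have [_] := supp x 0 ltac:(lra) xM; rewrite scale0r addr0 => ->.
    by rewrite subr0 normr0 ltW.
  have cD : Cc (fun x => - h * dG x + (G (x + h *: v) + -1 * G x)).
    by apply: CcD; [exact: CcZ|apply: CcD; [exact: Cc_shift|exact: CcZ]].
  have : `|rint (fun x => - h * dG x + (G (x + h *: v) + -1 * G x))| <= h * e * (2 * M) ^+ N.
    apply: rint_bound => // x.
      move=> xM; have [-> _] := supp x h ltac:(lra) xM.
      have [+ +] := supp x 0 ltac:(lra) xM; rewrite scale0r addr0 => -> ->.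
      by rewrite !mulr0 !addr0.
    by rewrite addrC mulN1r mulNr.
  rewrite rint_lin//; last by apply: CcD; [exact: Cc_shift|exact: CcZ].
  rewrite rintD; [|exact: Cc_shift|exact: CcZ].
  rewrite rintZ// rint_shift// mulN1r subrr addr0 normrM normrN (gtr0_norm h0).
  by rewrite -mulrA ler_pM2l.
apply/eqP; rewrite -normr_le0; apply/ler_addgt0Pr => e e0; rewrite add0r.
have P0 : 0 <= (2 * M) ^+ N by apply: exprn_ge0; lra.
have d0 : 0 < e / ((2 * M) ^+ N + 1) by apply: divr_gt0 => //; lra.
apply: le_trans (key _ d0) _.
rewrite mulrAC ler_pdivrMr ?ler_pM2l//; lra.
Qed.

(** * Extension by zero off an open set *)

Section ZeroExtension.
Variables (R : realType) (N : nat) (D K : set 'rV[R]_N).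
Hypotheses (oD : open D) (cK : compact K) (KD : K `<=` D).

(** The same conditional as in [integral_on]. Formulas meaningful only on [D] thus become global
    functions, continuous as soon as they vanish on [D] outside the compact set [K]. *)
Definition zext (g : 'rV[R]_N -> R) : 'rV[R]_N -> R :=
  fun x => if `[< D x >] then g x else 0.

Lemma zext_in g x : D x -> zext g x = g x.
Proof. by move=> Dx; rewrite /zext; case: asboolP. Qed.

Lemma zext_near_in g x : D x -> \forall y \near x, g y = zext g y.
Proof.
move=> Dx; have : nbhs x D by apply: open_nbhs_nbhs.
by apply: filterS => y Dy; rewrite zext_in.
Qed.

Lemma near_notin_compact x : ~ K x -> \forall y \near x, ~ K y.
Proof.
move=> Kx; apply: (open_nbhs_nbhs (A := ~` K)); split => //.
by apply: closed_openC; apply: compact_closed => //; exact: norm_hausdorff.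
Qed.

Lemma zext_near_out g x : (forall y, D y -> ~ K y -> g y = 0) -> ~ K x ->
  \forall y \near x, 0 = zext g y.
Proof.
move=> g0 /near_notin_compact; apply: filterS => y Ky.
by rewrite /zext; case: asboolP => // Dy; rewrite g0.
Qed.

Lemma zext_Cc g : (forall x, D x -> {for x, continuous g}) ->
  (forall y, D y -> ~ K y -> g y = 0) -> Cc (zext g).
Proof.
move=> cg g0; split.
  move=> x; have [Kx|Kx] := pselect (K x).
    apply: (cvg_trans (near_eq_cvg (zext_near_in g (KD Kx)))).
    by rewrite zext_in; [exact/cg/KD|exact: KD].
  have H := zext_near_out g0 Kx.
  apply: (cvg_trans (near_eq_cvg H)).
  by rewrite -(nbhs_singleton H); exact: cvg_cst.
have [M [_ HM]] := compact_bounded cK.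
exists (M + 1) => x Mx; rewrite /zext; case: asboolP => // Dx; apply: g0 => // Kx.
have := HM (M + 1) _ x Kx; rewrite ltrDl ltr01 => /(_ isT) /=.
by rewrite leNgt Mx.
Qed.

(** Outside [K] the extension vanishes near the point, so its derivative there is 0; by uniqueness
    of derivatives [dF] must vanish on [D] outside [K], which is why it is a conclusion and not a
    premise. *)
Lemma is_derive_zext (F dF : 'rV[R]_N -> R) (v : 'rV[R]_N) :
  (forall x, D x -> is_derive x v F (dF x)) ->
  (forall x, D x -> ~ K x -> F x = 0) ->
  (forall x, D x -> ~ K x -> dF x = 0) /\
  (forall x, is_derive x v (zext F) (zext dF x)).
Proof.
move=> dFP F0.
have H0 x : ~ K x -> is_derive x v (zext F) 0.
  by move=> Kx; apply: (@near_eq_is_derive _ _ _ (cst 0) _ x v 0 (zext_near_out F0 Kx)).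
have HO x : D x -> is_derive x v (zext F) (dF x).
  move=> Ox; apply: (@near_eq_is_derive _ _ _ F _ x v _ (zext_near_in _ Ox)); exact: dFP.
have dF0 x : D x -> ~ K x -> dF x = 0.
  by move=> Ox Kx; apply: is_derive_uniq (HO x Ox) (H0 x Kx).
split=> // x; rewrite /zext; case: asboolP => Ox; first exact: HO.
by apply: H0 => /KD.
Qed.

End ZeroExtension.

(** * The divergence theorem on the punctured cylinder *)

Lemma continuous_at_sum (R : realType) (V : normedModType R) (n : nat)
    (F : 'I_n -> V -> R) (x : V) : (forall j, {for x, continuous (F j)}) ->
  {for x, continuous (fun y => \sum_(j < n) F j y)}.
Proof.
elim: n F => [|n IH] F cF.
  rewrite (_ : (fun y => _) = cst 0); first exact: cvg_cst.
  by apply/funext => y; rewrite big_ord0.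
rewrite (_ : (fun y => _) = (fun y => F ord0 y + \sum_(j < n) F (lift ord0 j) y)).
  by apply: cvgD; [exact: cF|apply: IH].
by apply/funext => y; rewrite big_ord_recl.
Qed.

Section Radial.
Variables (R : realType) (k m : nat) (r : R).
Hypothesis r0 : 0 < r.
Local Notation V := 'rV[R]_(k + m).
Local Notation Om := (@OmegaR R k m r).
Local Notation rho x := (enorm (lsubmx x : 'rV[R]_k)).
Local Notation L := (@logRx R k m r).
Local Notation e_ j := (delta_mx 0 (lshift m j) : V).

Lemma rhoE (x : V) : rho x = Num.sqrt (\sum_(j < k) x ord0 (lshift m j) ^+ 2).
Proof. by rewrite /enorm; congr Num.sqrt; apply: eq_bigr => j _; rewrite mxE. Qed.

Lemma rho_sqr (x : V) : rho x ^+ 2 = \sum_(j < k) x ord0 (lshift m j) ^+ 2.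
Proof. by rewrite rhoE sqr_sqrtr// sumr_ge0// => j _; exact: sqr_ge0. Qed.

Lemma rho_continuous : continuous (fun x : V => rho x).
Proof.
move=> x; rewrite (_ : (fun x : V => rho x) =
  Num.sqrt \o (fun x : V => \sum_(j < k) x ord0 (lshift m j) ^+ 2)).
  apply: continuous_comp; last exact: sqrt_continuous.
  apply: continuous_at_sum => j.
  apply: (@continuous_comp _ _ _ (fun x : V => x ord0 (lshift m j)) (fun t : R => t ^+ 2)).
    exact: coord_continuous.
  exact: exprn_continuous.
by apply/funext => y; rewrite rhoE.
Qed.

Lemma Om_open : open Om.
Proof.
have -> : Om = (fun x : V => rho x) @^-1` [set t : R | 0 < t] `&`
    (fun x : V => rho x) @^-1` [set t : R | t < r].
  by apply/seteqP; split => x; [move=> /andP[]|move=> [] /= a b; apply/andP; split].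
apply: openI.
  by apply: open_comp => [x _|]; [exact: rho_continuous|exact: open_gt].
by apply: open_comp => [x _|]; [exact: rho_continuous|exact: open_lt].
Qed.

Lemma Om_rho (x : V) : Om x -> 0 < rho x /\ rho x < r.
Proof. by move=> /andP[]. Qed.

Lemma L_gt0 (x : V) : Om x -> 0 < L x.
Proof.
move=> /Om_rho[h1 h2]; rewrite /logRx ln_gt0// ltr_pdivlMr//.
by rewrite mul1r.
Qed.

(** Through this formula every weight in |x'| and L becomes a function of L alone. *)
Lemma rho_expL (x : V) : Om x -> rho x = r * expR (- L x).
Proof.
move=> /Om_rho[h1 h2]; rewrite expRN /logRx lnK ?posrE ?divr_gt0//.
by rewrite invfM invrK mulrA mulfV ?mul1r// gt_eqF.
Qed.

Lemma powR_rho (x : V) (a : R) : Om x -> rho x `^ a = r `^ a * expR (- a * L x).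
Proof.
move=> Ox; rewrite {1}(rho_expL Ox) powRM ?(ltW r0) ?expR_ge0//; congr (_ * _).
by rewrite {1}/powR gt_eqF ?expR_gt0// expRK mulrN mulNr.
Qed.

Lemma L_derive (x : V) (j : 'I_k) : Om x ->
  is_derive x (e_ j) L (- (x ord0 (lshift m j) / rho x ^+ 2)).
Proof.
move=> Ox; have [h1 h2] := Om_rho Ox.
(* The square of the norm is a polynomial, so writing L = ln r - (1/2) ln u near x avoids
   differentiating the square root. *)
pose u := fun y : V => \sum_(i < k) y ord0 (lshift m i) ^+ 2.
have ux : 0 < u x by rewrite /u -rho_sqr exprn_gt0.
have du : is_derive x (e_ j) u (2 * x ord0 (lshift m j)).
  have H i : is_derive x (e_ j) (fun y : V => y ord0 (lshift m i) ^+ 2)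
     (2 * x ord0 (lshift m i) * (i == j)%:R).
    have Hc := @is_derive_coord R (k + m) x (e_ j) (lshift m i).
    have H := @is_deriveX R V (fun y : V => y ord0 (lshift m i)) 2 x (e_ j) _ Hc.
    apply: is_derive_eq H _.
    by rewrite expr1 !mxE eqxx /= (inj_eq (@lshift_inj k m)).
  rewrite (_ : u = \sum_(i < k) (fun y : V => y ord0 (lshift m i) ^+ 2)).
    apply: is_derive_eq.
    rewrite (bigD1 j)//= eqxx mulr1 big1 ?addr0// => i /negPf ->.
    by rewrite mulr0.
  by apply/funext => y; rewrite fct_sumE.
have EL : \forall y \near x, (fun y => ln r - 2^-1 * ln (u y)) y = L y.
  have : nbhs x Om by apply: open_nbhs_nbhs; split => //; exact: Om_open.
  apply: filterS => y /Om_rho[y1 y2]; rewrite /logRx ln_div ?posrE//.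
  congr (_ - _); rewrite /u -rho_sqr lnXn//; by set l := ln _; lra.
apply: near_eq_is_derive EL _.
have dln : is_derive x (e_ j) (@ln R \o u) ((u x)^-1 * (2 * x ord0 (lshift m j))).
  by apply: is_derive_comp_dir => //; exact: is_derive1_ln.
rewrite (_ : (fun y => _) = cst (ln r) - 2^-1 \*: (@ln R \o u)); last by apply/funext.
apply: is_derive_eq; rewrite sub0r /u -rho_sqr /GRing.scale /=.
by field; rewrite gt_eqF.
Qed.

Lemma L_continuous (x : V) : Om x -> {for x, continuous L}.
Proof.
move=> Ox; have [h1 h2] := Om_rho Ox.
apply: (@continuous_comp _ _ _ (fun y => r / rho y) (@ln R)).
  apply: (@continuousM R V (fun=> r) (fun y => (rho y)^-1)); first exact: cst_continuous.
  by apply: continuousV; [rewrite gt_eqF|exact: rho_continuous].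
by apply: continuous_ln; rewrite divr_gt0.
Qed.

Lemma x_grad_L (x : V) : Om x ->
  \sum_(j < k) x ord0 (lshift m j) * (- (x ord0 (lshift m j) / rho x ^+ 2)) = -1.
Proof.
move=> Ox; have [h1 _] := Om_rho Ox.
under eq_bigr do rewrite mulrN mulrA -expr2.
by rewrite sumrN -mulr_suml -rho_sqr mulfV// expf_neq0// gt_eqF.
Qed.

(** Each partial derivative of x_j F along x_j integrates to 0; the sum over j produces k copies of
    F and the term x' . grad F. *)
Lemma rint_divergence (K : set V) (F : V -> R) (dF : 'I_k -> V -> R) :
  compact K -> K `<=` Om ->
  (forall x, Om x -> {for x, continuous F}) ->
  (forall j x, Om x -> {for x, continuous (dF j)}) ->
  (forall j x, Om x -> is_derive x (e_ j) F (dF j x)) ->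
  (forall x, Om x -> ~ K x -> F x = 0) ->
  rint (zext Om (fun x => k%:R * F x + \sum_(j < k) x ord0 (lshift m j) * dF j x)) = 0.
Proof.
move=> cK KO cF cdF dFP F0.
pose G (j : 'I_k) (x : V) := x ord0 (lshift m j) * F x.
pose dG (j : 'I_k) (x : V) := F x + x ord0 (lshift m j) * dF j x.
have cx j x : {for x, continuous (fun y : V => y ord0 (lshift m j))}.
  exact: coord_continuous.
have dF0 j x : Om x -> ~ K x -> dF j x = 0.
  exact: (is_derive_zext (@Om_open) cK KO (dFP j) F0).1.
have cdG j : Cc (zext Om (dG j)).
  apply: (zext_Cc Om_open cK KO) => [x Ox|x Ox Kx].
    exact: (continuousD (cF x Ox) (continuousM (cx j x) (cdF j x Ox))).
  by rewrite /dG F0// dF0// mulr0 addr0.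
have I0 j : rint (zext Om (dG j)) = 0.
  have G0 x : Om x -> ~ K x -> G j x = 0 by move=> Ox Kx; rewrite /G F0// mulr0.
  apply: (@rint_derive_eq0 R _ (zext Om (G j)) _ (e_ j)) => //.
    apply: (zext_Cc Om_open cK KO) => // x Ox.
    exact: (continuousM (cx j x) (cF x Ox)).
  apply: (is_derive_zext (@Om_open) cK KO _ G0).2 => x Ox.
  have H1 := @is_derive_coord R (k + m) x (e_ j) (lshift m j).
  have H2 := dFP j x Ox.
  rewrite (_ : G j = (fun y : V => y ord0 (lshift m j)) * F)//.
  apply: is_derive_eq; rewrite /dG !mxE !eqxx /GRing.scale /= mulr1.
  by rewrite addrC.
have -> : zext Om (fun x => k%:R * F x + \sum_(j < k) x ord0 (lshift m j) * dF j x) =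
          (fun x => \sum_(j < k) zext Om (dG j) x).
  apply/funext => x; rewrite /zext; case: asboolP => Ox; last by rewrite big1.
  by rewrite /dG big_split /= sumr_const card_ord mulr_natl.
by rewrite rint_sum// big1.
Qed.

(** Case F = P phi(L) of the divergence theorem, where x' . grad L = -1 turns the derivative of the
    second factor into - phi'(L). Only the product is required to vanish off [K]: for the test
    functions the support is bounded in x' by phi and in x'' by P. *)
Lemma rint_radial (K : set V) (P : V -> R) (dP : 'I_k -> V -> R) (phi dphi : R -> R) :
  compact K -> K `<=` Om ->
  (forall x, Om x -> {for x, continuous P}) ->
  (forall j x, Om x -> {for x, continuous (dP j)}) ->
  (forall j x, Om x -> is_derive x (e_ j) P (dP j x)) ->
  (forall t : R, 0 < t -> {for t, continuous dphi}) ->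
  (forall t : R, 0 < t -> is_derive t 1 phi (dphi t)) ->
  (forall x, Om x -> ~ K x -> P x * phi (L x) = 0) ->
  rint (zext Om (fun x =>
    (k%:R * P x + \sum_(j < k) x ord0 (lshift m j) * dP j x) * phi (L x) - P x * dphi (L x))) = 0.
Proof.
move=> cK KO cP cdP dPP cdphi dphiP P0.
pose dF (j : 'I_k) (x : V) := dP j x * phi (L x) +
  P x * (dphi (L x) * (- (x ord0 (lshift m j) / rho x ^+ 2))).
have cphi (t : R) : 0 < t -> {for t, continuous phi}.
  move=> t0; apply/differentiable_continuous/derivable1_diffP.
  exact: (@ex_derive _ _ _ _ _ _ _ (dphiP t t0)).
have cphiL x : Om x -> {for x, continuous (phi \o L)}.
  move=> Ox; apply: continuous_comp; first exact: L_continuous.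
  exact/cphi/L_gt0.
have cdphiL x : Om x -> {for x, continuous (dphi \o L)}.
  move=> Ox; apply: continuous_comp; first exact: L_continuous.
  exact/cdphi/L_gt0.
etransitivity; last apply: (@rint_divergence K (fun x => P x * phi (L x)) dF cK KO) => //.
- congr rint; apply/funext => x; rewrite /zext; case: asboolP => // Ox.
  rewrite /dF; under [in RHS]eq_bigr do rewrite mulrDr.
  rewrite big_split /=.
  under [X in _ = _ + (_ + X)]eq_bigr do rewrite mulrCA [X in P x * X]mulrCA.
  rewrite -!mulr_sumr x_grad_L// mulrN1 mulrN addrA; congr (_ - _).
  rewrite mulrDl mulr_suml -mulrA; congr (_ + _).
  by apply: eq_bigr => j _; rewrite mulrA.
- by move=> x Ox; exact: (continuousM (cP x Ox) (cphiL x Ox)).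
- move=> j x Ox; have [h1 _] := Om_rho Ox.
  have cr : {for x, continuous (fun y : V => (rho y ^+ 2)^-1)}.
    apply: continuousV; first by rewrite expf_neq0// gt_eqF.
    apply: (@continuous_comp _ _ _ (fun y : V => rho y) (fun t : R => t ^+ 2)).
      exact: rho_continuous.
    exact: exprn_continuous.
  have cq := continuousN (continuousM (@coord_continuous R 1 (k + m) ord0 (lshift m j) x) cr).
  exact: (continuousD (continuousM (cdP j x Ox) (cphiL x Ox))
    (continuousM (cP x Ox) (continuousM (cdphiL x Ox) cq))).
- move=> j x Ox.
  have H1 := dPP j x Ox.
  have H2 : is_derive x (e_ j) (phi \o L) (dphi (L x) * (- (x ord0 (lshift m j) / rho x ^+ 2))).
    by apply: is_derive_comp_dir; [exact/dphiP/L_gt0|exact: L_derive].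
  rewrite (_ : (fun x => _) = P * (phi \o L))//.
  apply: is_derive_eq; rewrite /dF /GRing.scale /= addrC; congr (_ + _).
  by rewrite mulrC.
Qed.

End Radial.

(** * The functional [C_p] *)

Section Modulus.
Variable R : realType.
Implicit Types (z w : R[i]) (p : R).

Lemma cabs_ge0 z : 0 <= cabs z.
Proof. exact: sqrtr_ge0. Qed.

Lemma cabs_sqr z : cabs z ^+ 2 = complex.Re z ^+ 2 + complex.Im z ^+ 2.
Proof. by rewrite sqr_sqrtr// addr_ge0// sqr_ge0. Qed.

Lemma cabs_eq0 z : cabs z = 0 -> z = 0.
Proof.
move=> z0; have := cabs_sqr z; rewrite z0 expr0n /= => /esym/eqP.
rewrite paddr_eq0 ?sqr_ge0// !sqrf_eq0.
by case: z {z0} => a b /= /andP[/eqP -> /eqP ->].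
Qed.

Lemma cabs0 : cabs (0 : R[i]) = 0.
Proof. by rewrite /cabs /= expr0n /= addr0 sqrtr0. Qed.

Lemma cabsZ (c : R) z : cabs (c%:C%C * z) = `|c| * cabs z.
Proof.
case: z => a b; rewrite /cabs /= !mul0r subr0 addr0 !exprMn -mulrDr.
by rewrite sqrtrM ?sqr_ge0// sqrtr_sqr.
Qed.

Lemma Re_conjM z w :
  complex.Re (z * w^*)%C = complex.Re z * complex.Re w + complex.Im z * complex.Im w.
Proof. by case: z => a b; case: w => c d /=; rewrite mulrN opprK. Qed.

Lemma Re_conjM_le z w : complex.Re (z * w^*)%C <= cabs z * cabs w.
Proof.
rewrite Re_conjM; apply: le_trans (ler_norm _) _.
rewrite -(@ler_pXn2r _ 2) ?nnegrE ?mulr_ge0 ?cabs_ge0//.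
rewrite exprMn !cabs_sqr real_normK ?num_real//.
have := sqr_ge0 (complex.Re z * complex.Im w - complex.Im z * complex.Re w).
by nra.
Qed.

Lemma powR_gt1 (t a : R) : 1 < t -> 0 < a -> 1 < t `^ a.
Proof.
move=> t1 a0; have := @gt0_ltr_powR R a a0 1 t.
by rewrite powR1 !nnegrE; apply => //; lra.
Qed.

Lemma powR_lt1 (t a : R) : 0 <= t -> t < 1 -> 0 < a -> t `^ a < 1.
Proof.
move=> t0 t1 a0; have := @gt0_ltr_powR R a a0 t 1.
by rewrite powR1 !nnegrE; apply => //; lra.
Qed.

(** The mean value theorem on the interval between y and 1 compares the slope p t^(p - 1) strictly
    with p. The point y = 0, where the power need not be treated as differentiable, is settled by 1
    - p < 0. *)
Lemma bernoulli_lt p (y : R) : 1 < p -> 0 <= y -> y != 1 -> 1 + p * (y - 1) < y `^ p.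
Proof.
move=> p1; rewrite le_eqVlt => /predU1P[<- _|y0 y1].
  by rewrite powR0; lra.
have d (t : R) : 0 < t -> is_derive t 1 (@powR R ^~ p) (p * t `^ (p - 1)).
  exact: is_derive1_powR.
have c (a b : R) : 0 < a -> {within `[a, b], continuous (@powR R ^~ p)}.
  move=> a0; apply: derivable_within_continuous => t; rewrite in_itv /= => /andP[at_ _].
  exact: (@ex_derive _ _ _ _ _ _ _ (d t (lt_le_trans a0 at_))).
case: (ltP y 1) => [ylt|]; last rewrite le_eqVlt eq_sym (negPf y1) /= => ygt.
  have dy t : t \in `]y, 1[ -> is_derive t 1 (@powR R ^~ p) (p * t `^ (p - 1)).
    by rewrite in_itv /= => /andP[yt _]; apply: d; exact: lt_trans yt.
  have [e +] := MVT ylt dy (c y 1 y0).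
  rewrite in_itv /= powR1 => /andP[ye e1].
  have := @powR_lt1 e (p - 1) ltac:(lra) e1 ltac:(lra).
  set q := e `^ _ => q1 E.
  have : 0 < p * (1 - q) * (1 - y) by rewrite !mulr_gt0//; lra.
  by move: E; lra.
have dy t : t \in `]1, y[ -> is_derive t 1 (@powR R ^~ p) (p * t `^ (p - 1)).
  by rewrite in_itv /= => /andP[yt _]; apply: d; exact: lt_trans yt.
have [e +] := MVT ygt dy (c 1 y ltr01).
rewrite in_itv /= powR1 => /andP[e1 ey].
have := @powR_gt1 e (p - 1) e1 ltac:(lra).
set q := e `^ _ => q1 E.
have : 0 < p * (q - 1) * (y - 1) by rewrite !mulr_gt0//; lra.
by move: E; lra.
Qed.

(** Bernoulli's inequality at x / z, multiplied by z^p; strictness is what later identifies the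
    zeros of [Cp]. *)
Lemma young_lt p (x z : R) : 1 < p -> 0 <= x -> 0 <= z -> x != z ->
  p * z `^ (p - 1) * x < x `^ p + (p - 1) * z `^ p.
Proof.
move=> p1 x0; rewrite le_eqVlt => /predU1P[<-|z0] xz.
  rewrite !powR0 ?subr_eq0 ?gt_eqF//; [|lra].
  by rewrite !mulr0 mul0r addr0 powR_gt0// lt_neqAle eq_sym xz.
have xz1 : x / z != 1.
  apply: contra xz => /eqP h; have : x / z * z = z by rewrite h mul1r.
  by rewrite divfK ?(gt_eqF z0)// => ->.
have := @bernoulli_lt p (x / z) p1 ltac:(by rewrite divr_ge0// ltW) xz1.
rewrite -(@ltr_pM2r _ (z `^ p)) ?powR_gt0// -powRM ?divr_ge0 ?(ltW z0)//.
rewrite divfK ?gt_eqF//.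
have E : z `^ p = z * z `^ (p - 1) by rewrite mulr_powRB1 ?(ltW z0)//; lra.
rewrite E.
have -> : (1 + p * (x / z - 1)) * (z * z `^ (p - 1)) =
  p * z `^ (p - 1) * x - (p - 1) * (z * z `^ (p - 1)).
  by field; rewrite gt_eqF.
lra.
Qed.

(** At s = 0 both sides vanish, so for p < 2 the negative exponent causes no case distinction at the
    zeros of f. *)
Lemma powR_sub2_sqr (s p : R) : 0 <= s -> 1 < p -> s `^ (p - 2) * s ^+ 2 = s `^ p.
Proof.
rewrite le_eqVlt => /predU1P[<-|s0] p1.
  by rewrite expr0n mulr0 powR0//; lra.
by rewrite -powR_mulrn ?(ltW s0)// -powRD ?(gt_eqF s0) ?implybT// subrK.
Qed.

Lemma powR_sub2_mul (s p : R) : 0 <= s -> 1 < p -> s `^ (p - 2) * s = s `^ (p - 1).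
Proof.
rewrite le_eqVlt => /predU1P[<-|s0] p1.
  by rewrite mulr0 powR0//; lra.
by rewrite -{2}[s]powRr1 ?(ltW s0)// -powRD ?(gt_eqF s0) ?implybT//; congr (_ `^ _); lra.
Qed.

(** Substituting w = z - (z - w) in the scalar product gives the two sides of Young's inequality for
    |z| and |z - w|, up to Cauchy-Schwarz. The formula also covers z = w, so the case split in [Cp]
    disappears. *)
Lemma CpE p z w : 1 < p ->
  Cp p z w = cabs z `^ p + (p - 1) * cabs (z - w) `^ p
             - p * cabs (z - w) `^ (p - 2) * complex.Re ((z - w) * z^*)%C.
Proof.
move=> p1; rewrite /Cp; case: eqP => [->|_].
  by rewrite subrr mul0r /= cabs0 powR0 ?mulr0 ?addr0 ?subr0//; lra.
have -> : complex.Re ((z - w) * w^*)%C =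
          complex.Re ((z - w) * z^*)%C - cabs (z - w) ^+ 2.
  rewrite cabs_sqr !Re_conjM; case: z => a b; case: w => c d /=; ring.
rewrite -(@powR_sub2_sqr (cabs (z - w)) p (cabs_ge0 _) p1).
ring.
Qed.

(** Two inequalities are chained: Cauchy-Schwarz, then Young. Young is strict unless |z| = |z - w|,
    and in that case Cauchy-Schwarz is strict unless w = 0. *)
Lemma Cp_gt0 p z w : 1 < p -> w != 0 -> 0 < Cp p z w.
Proof.
move=> p1 w0; rewrite CpE//; set s := cabs (z - w).
have s0 : 0 <= s := cabs_ge0 _.
have x0 := cabs_ge0 z.
have h2 : s `^ (p - 2) * complex.Re ((z - w) * z^*)%C <= s `^ (p - 1) * cabs z.
  rewrite -powR_sub2_mul// -mulrA ler_wpM2l ?powR_ge0//.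
  exact: Re_conjM_le.
have [E|ne] := eqVneq (cabs z) s; last first.
  have := @young_lt p (cabs z) s p1 x0 s0 ne.
  have : p * (s `^ (p - 2) * complex.Re ((z - w) * z^*)%C) <= p * (s `^ (p - 1) * cabs z).
    by rewrite ler_pM2l//; lra.
  lra.
have sp : 0 < s.
  rewrite lt_neqAle s0 andbT eq_sym; apply/eqP => s00.
  move: E; rewrite s00 => /cabs_eq0 z0.
  move: s00; rewrite /s z0 sub0r => /cabs_eq0/eqP; rewrite oppr_eq0.
  by move/eqP => w00; rewrite w00 eqxx in w0.
have sp2 : 0 < s `^ (p - 2) by exact: powR_gt0.
(* When |z| = s, expanding |w|^2 = |z - (z - w)|^2 gives 2 s^2 - 2 Re ((z - w) conj z), which is
   positive. *)
suff h : complex.Re ((z - w) * z^*)%C < s ^+ 2.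
  have : p * (s `^ (p - 2) * complex.Re ((z - w) * z^*)%C) < p * (s `^ (p - 2) * s ^+ 2).
    by rewrite ltr_pM2l ?ltr_pM2l//; lra.
  rewrite E powR_sub2_sqr//; lra.
have hw : 0 < cabs w ^+ 2.
  apply: exprn_gt0; rewrite lt_neqAle cabs_ge0 andbT eq_sym; apply/eqP => /cabs_eq0 w00.
  by rewrite w00 eqxx in w0.
have hE : cabs z ^+ 2 = s ^+ 2 by rewrite E.
move: hE hw; rewrite /s !cabs_sqr !Re_conjM.
case: (z) => a b; case: (w) => c d /=; nra.
Qed.

Lemma Cp_ge0 p z w : 1 < p -> 0 <= Cp p z w.
Proof.
move=> p1; have [->|w0] := eqVneq w 0; last exact/ltW/Cp_gt0.
rewrite CpE// subr0 Re_conjM -!expr2 -cabs_sqr -mulrA powR_sub2_sqr ?cabs_ge0//.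
lra.
Qed.

End Modulus.

(** * Powers of the modulus *)

Section PowerOfModulus.
Variables (R : realType) (V : normedModType R).

Lemma continuous_powR_gt0 (T : topologicalType) (g : T -> R) (x : T) (a : R) :
  {for x, continuous g} -> 0 < g x -> {for x, continuous (fun y => g y `^ a)}.
Proof.
move=> cg gx; apply: (@continuous_comp _ _ _ g (fun t : R => t `^ a)) => //.
apply/differentiable_continuous/derivable1_diffP.
exact: (@ex_derive _ _ _ _ _ _ _ (is_derive1_powR a gx)).
Qed.

Lemma cvg_powR0 (T : Type) (F : set_system T) (g : T -> R) (a : R) : Filter F ->
  (forall y, 0 <= g y) -> 0 < a -> g y @[y --> F] --> (0 : R) ->
  g y `^ a @[y --> F] --> (0 : R).
Proof.
move=> FF g0 a0 cg; apply/cvgrPdist_lt => e e0.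
have d0 : 0 < e `^ a^-1 by exact: powR_gt0.
near=> y.
have : `|0 - g y| < e `^ a^-1 by near: y; exact: cvgr_dist_lt.
rewrite !sub0r !normrN !ger0_norm ?powR_ge0// => gy.
have := @gt0_ltr_powR R a a0 (g y) (e `^ a^-1) _ _ gy.
rewrite -powRrM mulVf ?gt_eqF// powRr1 ?(ltW e0)//; apply.
  by rewrite nnegrE.
by rewrite nnegrE powR_ge0.
Unshelve. all: by end_near. Qed.

Lemma continuous_powR_ge0 (T : topologicalType) (g : T -> R) (x : T) (a : R) :
  {for x, continuous g} -> (forall y, 0 <= g y) -> 0 < a ->
  {for x, continuous (fun y => g y `^ a)}.
Proof.
move=> cg g0 a0; have := g0 x; rewrite le_eqVlt => /predU1P[gx|gx]; last first.
  exact: continuous_powR_gt0.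
have gx0 : g x `^ a = 0 by rewrite -gx powR0 ?gt_eqF.
have H : g y `^ a @[y --> x] --> (0 : R).
  by apply: cvg_powR0 => //; rewrite gx; exact: cg.
by rewrite -gx0 in H.
Qed.

Variables (a b : V -> R) (x v : V) (da db : R).
Local Notation s y := (Num.sqrt (a y ^+ 2 + b y ^+ 2)).

Lemma continuous_modulus (y : V) : {for y, continuous a} -> {for y, continuous b} ->
  {for y, continuous (fun y => s y)}.
Proof.
move=> ca cb; apply: (@continuous_comp _ _ _ (fun y => a y ^+ 2 + b y ^+ 2) (@Num.sqrt R)).
  apply: continuousD.
    by apply: (@continuous_comp _ _ _ a (fun t : R => t ^+ 2)) => //; exact: exprn_continuous.
  by apply: (@continuous_comp _ _ _ b (fun t : R => t ^+ 2)) => //; exact: exprn_continuous.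
exact: sqrt_continuous.
Qed.

(** Away from zeros of the modulus this is the chain rule. At a zero, the modulus at x + h v is |h|
    q(h) with q convergent, so the difference quotient is of order |h|^(p - 1) and tends to 0
    because p > 1. *)
Lemma is_derive_modulus_powR (p : R) : 1 < p ->
  is_derive x v a da -> is_derive x v b db ->
  is_derive x v (fun y => s y `^ p) (p * s x `^ (p - 2) * (a x * da + b x * db)).
Proof.
move=> p1 Ha Hb.
have N0 y : 0 <= a y ^+ 2 + b y ^+ 2 by rewrite addr_ge0// sqr_ge0.
have := N0 x; rewrite le_eqVlt => /predU1P[Nx|Nx]; last first.
  have sx : 0 < s x by rewrite sqrtr_gt0.
  have H1 : is_derive x v (fun y => a y ^+ 2 + b y ^+ 2) (2 * a x * da + 2 * b x * db).
    have H2 := is_deriveD (@is_deriveX R V a 2 x v _ Ha) (@is_deriveX R V b 2 x v _ Hb).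
    by apply: is_derive_eq H2 _; rewrite !expr1.
  have H2 := @is_derive_comp_dir R V _ (fun y => a y ^+ 2 + b y ^+ 2) x v _ _ (is_derive1_sqrt Nx) H1.
  have H3 := @is_derive_comp_dir R V _ (fun y => s y) x v _ _ (is_derive1_powR p sx) H2.
  apply: is_derive_eq H3 _.
  rewrite -(@powR_sub2_mul _ (s x) p (ltW sx) p1).
  by field; rewrite gt_eqF.
have ax : a x = 0.
  by apply/eqP; rewrite -sqrf_eq0 eq_le sqr_ge0 andbT Nx lerDl sqr_ge0.
have bx : b x = 0.
  by apply/eqP; rewrite -sqrf_eq0 eq_le sqr_ge0 andbT Nx lerDr sqr_ge0.
rewrite ax bx !mul0r addr0 mulr0.
pose qa (h : R) := h^-1 *: ((a \o shift x) (h *: v) - a x).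
pose qb (h : R) := h^-1 *: ((b \o shift x) (h *: v) - b x).
have ca : qa h @[h --> 0^'] --> da.
  by have [D1 <-] := Ha; exact: D1.
have cb : qb h @[h --> 0^'] --> db.
  by have [D1 <-] := Hb; exact: D1.
pose q h := Num.sqrt (qa h ^+ 2 + qb h ^+ 2).
have cq : q h @[h --> 0^'] --> Num.sqrt (da ^+ 2 + db ^+ 2).
  apply: (@continuous_cvg _ _ _ _ _ (fun h => qa h ^+ 2 + qb h ^+ 2) (@Num.sqrt R)).
    exact: sqrt_continuous.
  apply: cvgD.
    apply: (@continuous_cvg _ _ _ _ _ qa (fun t : R => t ^+ 2)) => //.
    exact: exprn_continuous.
  apply: (@continuous_cvg _ _ _ _ _ qb (fun t : R => t ^+ 2)) => //.
  exact: exprn_continuous.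
have sE (h : R) : h != 0 -> s (h *: v + x) = `|h| * q h.
  move=> h0; rewrite /q /qa /qb ax bx !subr0 /= /shift /= /GRing.scale /= !exprMn -mulrDr.
  rewrite sqrtrM ?sqr_ge0// sqrtr_sqr normfV mulrA mulfV ?mul1r//.
  by rewrite normr_eq0.
have ch : `|h| @[h --> (0 : R)^'] --> (0 : R).
  apply: cvg_within_filter.
  by have := @norm_continuous R R 0; rewrite /continuous_at normr0.
have cs : `|h| * q h @[h --> (0 : R)^'] --> (0 : R).
  by have H := cvgM ch cq; rewrite mul0r in H; exact: H.
have cs1 : (`|h| * q h) `^ (p - 1) @[h --> (0 : R)^'] --> (0 : R).
  apply: cvg_powR0 => //; last lra.
  by move=> h; rewrite mulr_ge0// sqrtr_ge0.
have lim0 : h^-1 *: (((fun y => s y `^ p) \o shift x) (h *: v) - s x `^ p) @[h --> 0^'] --> (0 : R).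
  apply/cvgr0Pnorm_lt => e e0.
  have c0 : q h * (`|h| * q h) `^ (p - 1) @[h --> (0 : R)^'] --> (0 : R).
    by have H := cvgM cq cs1; rewrite mulr0 in H; exact: H.
  have H := cvgr0_norm_lt _ c0 _ e0.
  near=> h.
  have h0 : h != 0 by near: h; exact: nbhs_dnbhs_neq.
  rewrite /= /shift sE// -Nx sqrtr0 powR0 ?subr0; last lra.
  rewrite [X in `|X|](_ : _ = h^-1 * `|h| * (q h * (`|h| * q h) `^ (p - 1))); last first.
    rewrite -[LHS]/(h^-1 * _) -mulrA; congr (_ * _); rewrite mulrA mulr_powRB1//; last lra.
    by rewrite mulr_ge0// sqrtr_ge0.
  rewrite normrM [`|h^-1 * _|]normrM normfV normr_id mulVf ?normr_eq0// mul1r.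
  by near: h; exact: H.
apply: DeriveDef; first by apply/cvg_ex; exists 0.
exact: cvg_lim.
Unshelve. all: by end_near. Qed.

End PowerOfModulus.

(** At a zero of the modulus s the factor s^(p - 2) may blow up, but a and b are bounded by s, so
    the expression is at most p s^(p - 1) (|da| + |db|). *)
Lemma continuous_modulus_derive (R : realType) (V : normedModType R)
    (a b da db : V -> R) (x : V) (p : R) : 1 < p ->
  {for x, continuous a} -> {for x, continuous b} ->
  {for x, continuous da} -> {for x, continuous db} ->
  {for x, continuous (fun y => p * Num.sqrt (a y ^+ 2 + b y ^+ 2) `^ (p - 2)
     * (a y * da y + b y * db y))}.
Proof.
move=> p1 ca cb cda cdb.
have cs := continuous_modulus ca cb.
set s := fun y => Num.sqrt (a y ^+ 2 + b y ^+ 2).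
have s0 y : 0 <= s y by exact: sqrtr_ge0.
have cl := continuousD (continuousM ca cda) (continuousM cb cdb).
have := s0 x; rewrite le_eqVlt => /predU1P[sx|sx]; last first.
  apply: (continuousM _ cl); apply: (@continuousM _ _ (fun=> p)); first exact: cst_continuous.
  exact: continuous_powR_gt0.
have ax y : `|a y| <= s y.
  by rewrite -sqrtr_sqr ler_wsqrtr// lerDl sqr_ge0.
have bx y : `|b y| <= s y.
  by rewrite -sqrtr_sqr ler_wsqrtr// lerDr sqr_ge0.
have E0 : a x * da x + b x * db x = 0.
  have := ax x; have := bx x; rewrite -sx !normr_le0 => /eqP -> /eqP ->.
  by rewrite !mul0r addr0.
have v0 : p * s x `^ (p - 2) * (a x * da x + b x * db x) = 0 by rewrite E0 mulr0.
suff H : p * s y `^ (p - 2) * (a y * da y + b y * db y) @[y --> x] --> (0 : R).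
  by rewrite -v0 in H; exact: H.
apply/cvgr0Pnorm_lt => e e0.
have c0 : p * s y `^ (p - 1) * (`|da y| + `|db y|) @[y --> x] --> (0 : R).
  have c1 : s y `^ (p - 1) @[y --> x] --> (0 : R).
    by apply: cvg_powR0 => //; [lra|rewrite sx; exact: cs].
  have H := cvgM (cvgM (cvg_cst p) c1) (cvgD (cvg_norm cda) (cvg_norm cdb)).
  by rewrite mulr0 mul0r in H; exact: H.
near=> y; apply: (@le_lt_trans _ _ `|p * s y `^ (p - 1) * (`|da y| + `|db y|)|); last first.
  by near: y; exact: (cvgr0_norm_lt _ c0).
rewrite -powR_sub2_mul// [leLHS]normrM [leRHS]normrM.
rewrite [`|p * _|]ger0_norm; last by rewrite mulr_ge0 ?powR_ge0//; lra.
rewrite [`|p * _|]ger0_norm; last by rewrite mulr_ge0 ?mulr_ge0 ?powR_ge0//; lra.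
rewrite mulrA -[leRHS]mulrA; apply: ler_wpM2l; first by rewrite mulr_ge0 ?powR_ge0//; lra.
rewrite [`|_ + `|_| |]ger0_norm ?addr_ge0// mulrDr.
apply: le_trans (ler_normD _ _) _; rewrite !normrM.
by apply: lerD; apply: ler_wpM2r.
Unshelve. all: by end_near. Qed.

(** * The divergence identity *)

Lemma powRV (R : realType) (w a : R) : 0 < w -> w^-1 `^ a = (w `^ a)^-1.
Proof. by move=> w0; rewrite -powR_inv1 ?(ltW w0)// -powRrM mulN1r powRN. Qed.

Lemma gt0_powRD (R : realType) (w a b : R) : 0 < w -> w `^ (a + b) = w `^ a * w `^ b.
Proof. by move=> w0; rewrite powRD// (gt_eqF w0) implybT. Qed.

Lemma continuousZ_fun (R : realType) (T : topologicalType) (c : R) (g : T -> R) (x : T) :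
  {for x, continuous g} -> {for x, continuous (fun y => c * g y)}.
Proof. by move=> cg; exact: (continuousM (@cst_continuous _ _ c x) cg). Qed.

Lemma Re_sum (R : realType) (n : nat) (F : 'I_n -> R[i]) :
  complex.Re (\sum_(j < n) F j) = \sum_(j < n) complex.Re (F j).
Proof. by apply: (big_morph _ (id1 := 0) (op1 := +%R)) => // -[a b] [c d]. Qed.

Lemma Im_sum (R : realType) (n : nat) (F : 'I_n -> R[i]) :
  complex.Im (\sum_(j < n) F j) = \sum_(j < n) complex.Im (F j).
Proof. by apply: (big_morph _ (id1 := 0) (op1 := +%R)) => // -[a b] [c d]. Qed.

Section Identity.
Variables (R : realType) (k m : nat) (r p : R).
Hypotheses (r0 : 0 < r) (p1 : 1 < p).
Local Notation V := 'rV[R]_(k + m).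
Local Notation Om := (@OmegaR R k m r).
Local Notation rho x := (enorm (lsubmx x : 'rV[R]_k)).
Local Notation L := (@logRx R k m r).
Local Notation e_ j := (delta_mx 0 (lshift m j) : V).

Let p_gt0 : 0 < p := lt_trans ltr01 p1.

Lemma continuous_weight (x : V) (A B : R) : Om x ->
  {for x, continuous (fun y : V => (rho y `^ A * L y `^ B)^-1)}.
Proof.
move=> Ox; have [h1 _] := Om_rho Ox; have h2 := L_gt0 Ox.
apply: continuousV; first by rewrite gt_eqF// mulr_gt0// powR_gt0.
apply: continuousM.
  by apply: (@continuous_powR_gt0 _ _ (fun y : V => rho y)) => //; exact: rho_continuous.
by apply: continuous_powR_gt0 => //; exact: L_continuous.
Qed.

(** Displays the weight as phi(L) with phi(t) = r^-A exp(A t) t^-B, the form that [rint_radial]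
    takes. *)
Lemma weightE (x : V) (A B : R) : Om x ->
  (rho x `^ A * L x `^ B)^-1 = r `^ (- A) * (expR (A * L x) * L x `^ (- B)).
Proof.
move=> Ox; rewrite (powR_rho r0)// !invfM !powRN mulrA; congr (_ * _ * _).
by rewrite -expRN mulNr opprK.
Qed.

Lemma integral_on_rint (g : V -> R) : Cc (zext Om g) ->
  integral_on Om (fun x => (g x)%:E) = (rint (zext Om g))%:E.
Proof.
move=> cg; rewrite -iint_rint// /integral_on; congr iint.
by apply/funext => x; rewrite /zext; case: asboolP.
Qed.

Variable f : V -> R[i].
Variable K : set V.
Hypotheses (cK : compact K) (KO : K `<=` Om) (fK : forall x, ~ K x -> f x = 0).
Hypotheses (sa : smooth (fun x => complex.Re (f x))) (sb : smooth (fun x => complex.Im (f x))).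
Local Notation a := (fun x => complex.Re (f x)).
Local Notation b := (fun x => complex.Im (f x)).
Local Notation Ef := (xgrad f).

Lemma smooth_continuous (g : V -> R) : smooth g -> continuous g.
Proof. by move=> sg; have [] := sg [::]. Qed.

Lemma smooth_derive (g : V -> R) (x v : V) : smooth g -> is_derive x v g (derive g x v).
Proof. by move=> sg; apply: derivableP; have [_] := sg [::]; exact. Qed.

Lemma smooth_derive_continuous (g : V -> R) (v : V) : smooth g ->
  continuous (fun x => derive g x v).
Proof. by move=> sg; have [] := sg [:: v]. Qed.

Lemma Re_xgrad (x : V) :
  complex.Re (Ef x) = \sum_(j < k) x ord0 (lshift m j) * derive a x (e_ j).
Proof.
by rewrite /xgrad Re_sum; apply: eq_bigr => j _; rewrite /= mul0r subr0.
Qed.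

Lemma Im_xgrad (x : V) :
  complex.Im (Ef x) = \sum_(j < k) x ord0 (lshift m j) * derive b x (e_ j).
Proof.
by rewrite /xgrad Im_sum; apply: eq_bigr => j _; rewrite /= mul0r addr0.
Qed.

Lemma xgrad_sum_continuous (g : V -> R) : smooth g ->
  continuous (fun x : V => \sum_(j < k) x ord0 (lshift m j) * derive g x (e_ j)).
Proof.
move=> sg x; apply: continuous_at_sum => j; apply: continuousM.
  exact: coord_continuous.
exact: smooth_derive_continuous.
Qed.

Lemma Re_xgrad_continuous : continuous (fun x => complex.Re (Ef x)).
Proof. under [X in continuous X]eq_fun do rewrite Re_xgrad; exact: xgrad_sum_continuous. Qed.

Lemma Im_xgrad_continuous : continuous (fun x => complex.Im (Ef x)).
Proof. under [X in continuous X]eq_fun do rewrite Im_xgrad; exact: xgrad_sum_continuous. Qed.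

Lemma xgrad_out (x : V) : ~ K x -> Ef x = 0.
Proof.
move=> Kx; rewrite /xgrad big1// => j _.
have d0 (g : V -> R) : (forall y, ~ K y -> g y = 0) -> derive g x (e_ j) = 0.
  move=> g0; rewrite -(@near_eq_derive _ _ _ (cst 0) g) ?derive_cst//.
  by have := near_notin_compact cK Kx; apply: filterS => y Ky; rewrite g0.
rewrite /cpartial !d0 ?mulr0//; by move=> y Ky; rewrite fK.
Qed.

Lemma Cc_density (g : V -> R) (A B : R) : continuous g -> (forall x, ~ K x -> g x = 0) ->
  Cc (zext Om (fun x => g x / (rho x `^ A * L x `^ B))).
Proof.
move=> cg g0; apply: (zext_Cc (@Om_open R k m r) cK KO) => [x Ox|x Ox Kx].
  by apply: (continuousM (cg x)); exact: continuous_weight.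
by rewrite g0// mul0r.
Qed.

Lemma cabs_powR_continuous : continuous (fun x => cabs (f x) `^ p).
Proof.
move=> x; apply: (@continuous_powR_ge0 R V (fun y => cabs (f y))) => [|y|]; [|exact: cabs_ge0|exact: p_gt0].
exact: (continuous_modulus (@smooth_continuous a sa x) (@smooth_continuous b sb x)).
Qed.

Lemma cabs_xgrad_continuous : continuous (fun x => cabs (Ef x) `^ p).
Proof.
move=> x; apply: (@continuous_powR_ge0 R V (fun y => cabs (Ef y))) => [|y|]; [|exact: cabs_ge0|exact: p_gt0].
apply: (@continuous_modulus _ _ (fun x => complex.Re (Ef x)) (fun x => complex.Im (Ef x))).
  exact: Re_xgrad_continuous.
exact: Im_xgrad_continuous.
Qed.

(** Up to the factor p, the derivative x' . grad_k of |f|^p ([JdensE]). *)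
Definition Jdens (x : V) := cabs (f x) `^ (p - 2) * complex.Re (f x * (Ef x)^*)%C.

Lemma JdensE (x : V) : p * Jdens x = \sum_(j < k) x ord0 (lshift m j) *
  (p * cabs (f x) `^ (p - 2) * (a x * derive a x (e_ j) + b x * derive b x (e_ j))).
Proof.
rewrite /Jdens Re_conjM Re_xgrad Im_xgrad !mulr_sumr -big_split /= !mulr_sumr.
by apply: eq_bigr => j _; ring.
Qed.

Lemma Jdens_continuous : continuous Jdens.
Proof.
have -> : Jdens = (fun x => p^-1 * (p * cabs (f x) `^ (p - 2) *
    (a x * complex.Re (Ef x) + b x * complex.Im (Ef x)))).
  apply/funext => x; rewrite /Jdens Re_conjM !mulrA mulVf ?mul1r//.
  by rewrite gt_eqF//; lra.
move=> x; apply: (@continuousZ_fun R V).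
apply: (@continuous_modulus_derive _ _ a b (fun x => complex.Re (Ef x))
  (fun x => complex.Im (Ef x)) x p p1).
- exact: (@smooth_continuous a sa).
- exact: (@smooth_continuous b sb).
- exact: Re_xgrad_continuous.
- exact: Im_xgrad_continuous.
Qed.

Lemma cabs_out (x : V) : ~ K x -> cabs (f x) `^ p = 0.
Proof. by move=> Kx; rewrite fK// cabs0 powR0 ?gt_eqF. Qed.

Lemma cabs_xgrad_out (x : V) : ~ K x -> cabs (Ef x) `^ p = 0.
Proof. by move=> Kx; rewrite xgrad_out// cabs0 powR0 ?gt_eqF. Qed.

Lemma Jdens_out (x : V) : ~ K x -> Jdens x = 0.
Proof. by move=> Kx; rewrite /Jdens fK// mul0r /= mulr0. Qed.

Lemma rint_zextD (g h : V -> R) : Cc (zext Om g) -> Cc (zext Om h) ->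
  rint (zext Om (fun x => g x + h x)) = rint (zext Om g) + rint (zext Om h).
Proof.
move=> cg ch; rewrite -rintD//; congr rint; apply/funext => x.
by rewrite /zext; case: asboolP => //; rewrite addr0.
Qed.

Lemma rint_zextZ (c : R) (g : V -> R) : Cc (zext Om g) ->
  rint (zext Om (fun x => c * g x)) = c * rint (zext Om g).
Proof.
move=> cg; rewrite -rintZ//; congr rint; apply/funext => x.
by rewrite /zext; case: asboolP => //; rewrite mulr0.
Qed.

Lemma Cc_zextZ (c : R) (g : V -> R) : Cc (zext Om g) -> Cc (zext Om (fun x => c * g x)).
Proof.
move=> /(CcZ c); congr Cc; apply/funext => x.
by rewrite /zext; case: asboolP => //; rewrite mulr0.
Qed.

Lemma Cc_zextD (g h : V -> R) : Cc (zext Om g) -> Cc (zext Om h) ->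
  Cc (zext Om (fun x => g x + h x)).
Proof.
move=> cg ch; have := CcD cg ch; congr Cc; apply/funext => x.
by rewrite /zext; case: asboolP => //; rewrite addr0.
Qed.

Lemma divergence_identity (A B : R) :
  (k%:R - A) * rint (zext Om (fun x => cabs (f x) `^ p / (rho x `^ A * L x `^ B)))
  + p * rint (zext Om (fun x => Jdens x / (rho x `^ A * L x `^ B)))
  + B * rint (zext Om (fun x => cabs (f x) `^ p / (rho x `^ A * L x `^ (B + 1)))) = 0.
Proof.
have c1 B' := Cc_density A B' cabs_powR_continuous cabs_out.
have cJ := Cc_density A B Jdens_continuous Jdens_out.
rewrite -!rint_zextZ// -!rint_zextD//; try by do ?[exact: Cc_zextZ|apply: Cc_zextD].
pose phi (t : R) := r `^ (- A) * (expR (A * t) * t `^ (- B)).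
pose dphi (t : R) := r `^ (- A) * (A * (expR (A * t) * t `^ (- B))
  - B * (expR (A * t) * t `^ (- B - 1))).
pose dP (j : 'I_k) (x : V) := p * cabs (f x) `^ (p - 2) *
  (a x * derive a x (e_ j) + b x * derive b x (e_ j)).
have dE (t : R) : is_derive t 1 (fun t => expR (A * t)) (A * expR (A * t)).
  have H : is_derive t 1 (fun t : R => A * t) A.
    by have := @is_deriveZ R R R id A t 1 1 _; rewrite /GRing.scale /= mulr1; apply.
  have := @is_derive1_comp R (@expR R) (fun t => A * t) t _ _ (is_derive_expR _) H.
  by move=> H1; apply: is_derive_eq H1 _; rewrite mulrC.
have cE (t : R) : {for t, continuous (fun t => expR (A * t))}.
  apply/differentiable_continuous/derivable1_diffP.
  exact: (@ex_derive _ _ _ _ _ _ _ (dE t)).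
rewrite -[RHS](@rint_radial R k m r r0 K (fun x => cabs (f x) `^ p) dP phi dphi cK KO).
- congr rint; apply/funext => x; rewrite /zext; case: asboolP => // Ox.
  rewrite !weightE// -JdensE /phi /dphi opprD; ring.
- by move=> x _; exact: cabs_powR_continuous.
- move=> j x _; apply: continuous_modulus_derive => //.
  + exact: (@smooth_continuous a sa).
  + exact: (@smooth_continuous b sb).
  + exact: (@smooth_derive_continuous a _ sa).
  + exact: (@smooth_derive_continuous b _ sb).
- by move=> j x _; apply: is_derive_modulus_powR => //; exact: smooth_derive.
- move=> t t0; have cp (c : R) : {for t, continuous (fun t : R => t `^ c)}.
    exact: (@continuous_powR_gt0 _ _ id).
  apply: continuousZ_fun.
  apply: (@continuousB _ _ _ (fun t => A * (expR (A * t) * t `^ (- B)))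
    (fun t => B * (expR (A * t) * t `^ (- B - 1)))).
    apply: continuousZ_fun.
    exact: (continuousM (cE t) (cp _)).
  apply: continuousZ_fun.
  exact: (continuousM (cE t) (cp _)).
- move=> t t0.
  have H := is_deriveZ (r `^ (- A)) (is_deriveM (dE t) (is_derive1_powR (- B) t0)).
  apply: is_derive_eq H _; rewrite /dphi /GRing.scale /=; ring.
- by move=> x _ Kx; rewrite cabs_out// mul0r.
Qed.

End Identity.

(** * Hardy densities *)

Section Densities.
Variables (R : realType) (k m : nat) (r p alpha beta : R).
Hypotheses (r0 : 0 < r) (p1 : 1 < p).
Local Notation V := 'rV[R]_(k + m).
Local Notation Om := (@OmegaR R k m r).
Local Notation rho x := (enorm (lsubmx x : 'rV[R]_k)).
Local Notation L := (@logRx R k m r).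
Local Notation A0 := ((beta + p) / p).
Local Notation xi := (xi_fun r p alpha beta).
Local Notation eta := (eta_fun r p alpha beta).
Implicit Types (f : V -> R[i]) (x : V).

(** [dens1] to [dens4] are the integrands of [I1] to [I4] in the theorem; [densJ] is the cross term
    that the divergence identity eliminates. *)
Definition dens1 f x := cabs (f x) `^ p / (rho x `^ (alpha + p) * L x `^ (beta + p + 1)).
Definition dens2 f x := cabs (xgrad f x) `^ p / (rho x `^ (alpha + p) * L x `^ (beta + 1)).
Definition dens3 f x := cabs (f x) `^ p / (rho x `^ (alpha + p) * L x `^ (beta + p)).
Definition densJ f x := Jdens p f x / (rho x `^ (alpha + p) * L x `^ (beta + p)).
Definition dens4 f x := Cp p (xi f x) (eta f x).

Let p_gt0 : 0 < p := lt_trans ltr01 p1.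
Let p_neq0 : p != 0. Proof. by rewrite gt_eqF. Qed.

Lemma cabs_xi f x : Om x -> cabs (xi f x) `^ p = dens2 f x.
Proof.
move=> Ox; have [h1 _] := Om_rho Ox; have h2 := L_gt0 Ox.
rewrite /xi_fun cabsZ powRM ?cabs_ge0// gtr0_norm ?invr_gt0 ?mulr_gt0 ?powR_gt0//.
rewrite powRV ?mulr_gt0 ?powR_gt0// powRM ?powR_ge0// -!powRrM !divfK//.
by rewrite /dens2 mulrC.
Qed.

Lemma xi_sub_eta f x : xi f x - eta f x =
  (- (A0 / (rho x `^ ((alpha + p) / p) * L x `^ ((beta + p + 1) / p))))%:C%C * f x.
Proof. by rewrite /eta_fun opprD addrA subrr sub0r rmorphN mulNr. Qed.

Lemma cabs_xi_sub_eta f x : Om x ->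
  cabs (xi f x - eta f x) `^ p = `|A0| `^ p * dens1 f x.
Proof.
move=> Ox; have [h1 _] := Om_rho Ox; have h2 := L_gt0 Ox.
rewrite xi_sub_eta; set w := (X in _ / X).
have w0 : 0 < w by rewrite mulr_gt0 ?powR_gt0.
have wp : w `^ p = rho x `^ (alpha + p) * L x `^ (beta + p + 1).
  by rewrite powRM ?powR_ge0// -!powRrM !divfK.
rewrite cabsZ powRM ?cabs_ge0// normrN normrM powRM//.
rewrite (gtr0_norm (_ : 0 < w^-1)) ?invr_gt0// powRV// wp.
by rewrite /dens1 -mulrA; congr (_ * _); rewrite mulrC.
Qed.

Lemma dens4E f x : Om x -> dens4 f x = dens2 f x + (p - 1) * `|A0| `^ p * dens1 f x
  + p * (A0 * `|A0| `^ (p - 2)) * densJ f x.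
Proof.
move=> Ox; have [h1 _] := Om_rho Ox; have h2 := L_gt0 Ox.
rewrite /dens4 CpE// cabs_xi// cabs_xi_sub_eta// mulrA; congr (_ + _).
set w1 := rho x `^ ((alpha + p) / p) * L x `^ ((beta + p + 1) / p).
set w2 := rho x `^ ((alpha + p) / p) * L x `^ ((beta + 1) / p).
have w10 : 0 < w1 by rewrite mulr_gt0 ?powR_gt0.
have w20 : 0 < w2 by rewrite mulr_gt0 ?powR_gt0.
(* The exponents of L add up to (p - 1) (beta + p + 1) / p + (beta + 1) / p = beta + p. *)
have E : w1 `^ (p - 2) * w1 * w2 = rho x `^ (alpha + p) * L x `^ (beta + p).
  rewrite powR_sub2_mul ?(ltW w10)// /w1 /w2 powRM ?powR_ge0// -!powRrM.
  rewrite mulrACA -!gt0_powRD//; congr (_ `^ _ * _ `^ _); by field.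
have -> : complex.Re ((xi f x - eta f x) * (xi f x)^*)%C =
    - (A0 / w1) * w2^-1 * complex.Re (f x * (xgrad f x)^*)%C.
  rewrite !Re_conjM xi_sub_eta /xi_fun -/w1 -/w2.
  by case: (f x) => a b; case: (xgrad f x) => c d /=; ring.
rewrite xi_sub_eta -/w1 cabsZ powRM ?cabs_ge0// normrN normrM powRM//.
rewrite (gtr0_norm (_ : 0 < w1^-1)) ?invr_gt0// powRV//.
rewrite /densJ -E /Jdens.
have w1p : w1 `^ (p - 2) != 0 by rewrite gt_eqF// powR_gt0.
by field; rewrite w1p p_neq0 (gt_eqF w10) (gt_eqF w20).
Qed.

Variable f : V -> R[i].
Hypothesis Hf : C0inf Om f.

Lemma densities_Cc : [/\ Cc (zext Om (dens1 f)), Cc (zext Om (dens2 f)), Cc (zext Om (dens3 f)),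
  Cc (zext Om (densJ f)) & Cc (zext Om (dens4 f))].
Proof.
have [sa [sb [K [cK [KO fK]]]]] := Hf.
have C1 A B := Cc_density r0 cK KO A B (cabs_powR_continuous p1 sa sb) (cabs_out p1 fK).
have C2 : Cc (zext Om (dens2 f)).
  exact: (Cc_density r0 cK KO _ _ (cabs_xgrad_continuous p1 sa sb) (cabs_xgrad_out p1 cK fK)).
have CJ : Cc (zext Om (densJ f)).
  exact: (Cc_density r0 cK KO _ _ (Jdens_continuous p1 sa sb) (Jdens_out p fK)).
split=> //; [exact: C1|exact: C1|].
have -> : zext Om (dens4 f) = zext Om (fun x => dens2 f x
    + (p - 1) * `|A0| `^ p * dens1 f x + p * (A0 * `|A0| `^ (p - 2)) * densJ f x).
  by apply/funext => x; rewrite /zext; case: asboolP => // Ox; rewrite dens4E.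
apply: Cc_zextD; last exact: Cc_zextZ.
by apply: Cc_zextD => //; apply: Cc_zextZ; exact: C1.
Qed.

Lemma identity_rint :
  `|A0| `^ p * rint (zext Om (dens1 f)) = rint (zext Om (dens2 f))
   - ((k%:R - alpha - p) * A0 * `|A0| `^ (p - 2)) * rint (zext Om (dens3 f))
   - rint (zext Om (dens4 f)).
Proof.
have [C1 C2 C3 CJ C4] := densities_Cc.
have [sa [sb [K [cK [KO fK]]]]] := Hf.
have -> : rint (zext Om (dens4 f)) = rint (zext Om (dens2 f))
    + (p - 1) * `|A0| `^ p * rint (zext Om (dens1 f))
    + p * (A0 * `|A0| `^ (p - 2)) * rint (zext Om (densJ f)).
  rewrite -!rint_zextZ// -!rint_zextD//; try by do ?[exact: Cc_zextZ|apply: Cc_zextD].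
  by congr rint; apply/funext => x; rewrite /zext; case: asboolP => // Ox; rewrite dens4E.
have H : (k%:R - (alpha + p)) * rint (zext Om (dens3 f)) + p * rint (zext Om (densJ f))
    + (beta + p) * rint (zext Om (dens1 f)) = 0.
  exact: (divergence_identity r0 p1 cK KO fK sa sb (alpha + p) (beta + p)).
have := @powR_sub2_sqr R `|A0| p (normr_ge0 _) p1; rewrite real_normK ?num_real// => EP.
have EB : beta + p = A0 * p by rewrite divfK.
move: H EP EB; set Q := `|A0| `^ (p - 2); set P := `|A0| `^ p; set A1 := A0.
move: (rint _) (rint _) (rint _) (rint _) => r3 rJ r1 r2 H <- EB.
(* The difference of the two sides is A1 Q times the divergence identity, since beta + p = p A1 and
   A1^2 Q = |A1|^p. *)
rewrite EB in H; apply/eqP; rewrite -subr_eq0 -(mulr0 (A1 * Q)) -H; apply/eqP.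
ring.
Qed.

Lemma dens1_eq0 : rint (zext Om (dens1 f)) = 0 -> f = (fun _ => 0).
Proof.
move=> I0; have [C1 _ _ _ _] := densities_Cc.
have [sa [sb [K [cK [KO fK]]]]] := Hf.
apply/funext => x; have [Ox|Ox] := pselect (Om x); last by apply: fK => /KO.
have [h1 _] := Om_rho Ox; have h2 := L_gt0 Ox.
have w0 : 0 < rho x `^ (alpha + p) * L x `^ (beta + p + 1) by rewrite mulr_gt0 ?powR_gt0.
have d0 y : 0 <= zext Om (dens1 f) y.
  rewrite /zext; case: asboolP => // _.
  by rewrite divr_ge0 ?mulr_ge0 ?powR_ge0.
have := rint_eq0 C1 d0 I0 x; rewrite zext_in// => /eqP.
rewrite mulf_eq0 invr_eq0 (gt_eqF w0) orbF => /eqP /powR_eq0_eq0.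
exact: cabs_eq0.
Qed.

Lemma dens4_ge0 x : 0 <= zext Om (dens4 f) x.
Proof. by rewrite /zext; case: asboolP => // _; exact: Cp_ge0. Qed.

Lemma dens3_ge0 x : 0 <= zext Om (dens3 f) x.
Proof.
rewrite /zext; case: asboolP => // _.
by rewrite divr_ge0 ?mulr_ge0 ?powR_ge0.
Qed.

Lemma eta_eq0 : rint (zext Om (dens4 f)) = 0 -> forall x, Om x -> eta f x = 0.
Proof.
move=> I0 x Ox; have [_ _ _ _ C4] := densities_Cc.
have := rint_eq0 C4 dens4_ge0 I0 x; rewrite zext_in// => H.
apply/eqP/negPn/negP => /(Cp_gt0 (xi f x) p1).
by rewrite -/(dens4 f x) H ltxx.
Qed.

End Densities.

(* If [eta = 0] then [x' . grad f = - ((beta + p) / p) f / L]; inserting this in the divergence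
   identity with [beta + 1] in place of [beta] leaves exactly one copy of the integral of
   [|f|^p / (|x'|^k L^(beta + p + 2))], which therefore vanishes. *)
Lemma dens4_eq0 (R : realType) (k m : nat) (r p alpha beta : R) (f : 'rV[R]_(k + m) -> R[i]) :
  0 < r -> 1 < p -> k%:R = alpha + p -> C0inf (@OmegaR R k m r) f ->
  rint (zext (@OmegaR R k m r) (dens4 r p alpha beta f)) = 0 -> f = (fun _ => 0).
Proof.
move=> r0 p1 kE Hf I0; have eta0 := eta_eq0 r0 p1 Hf I0.
apply: (@dens1_eq0 R k m r p alpha (beta + 1) r0 p1 f Hf).
have [sa [sb [K [cK [KO fK]]]]] := Hf.
have p0 : p != 0 by rewrite gt_eqF//; lra.
have := divergence_identity r0 p1 cK KO fK sa sb (alpha + p) (beta + p + 1).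
rewrite -kE subrr mul0r add0r kE.
have -> : zext (@OmegaR R k m r) (fun x => Jdens p f x /
   (enorm (lsubmx x) `^ (alpha + p) * logRx r x `^ (beta + p + 1))) =
  zext (@OmegaR R k m r) (fun x => - ((beta + p) / p) * dens1 r p alpha (beta + 1) f x).
  apply/funext => x; rewrite /zext; case: asboolP => // Ox.
  have [h1 _] := Om_rho Ox; have h2 := L_gt0 Ox.
  have E : xgrad f x = (- ((beta + p) / p) / logRx r x)%:C%C * f x.
    have := eta0 x Ox; rewrite /eta_fun /xi_fun.
    set w1 := _ * _ `^ ((beta + p + 1) / p); set w2 := _ * _ `^ ((beta + 1) / p).
    have w20 : 0 < w2 by rewrite mulr_gt0 ?powR_gt0.
    (* The exponents (beta + p + 1) / p and (beta + 1) / p differ by exactly 1. *)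
    have wE : w1 = w2 * logRx r x.
      rewrite /w1 /w2 -mulrA -{3}[logRx r x]powRr1 ?(ltW h2)// -gt0_powRD//.
      by congr (_ * _ `^ _); field.
    rewrite wE; case: (xgrad f x) => u v; case: (f x) => a b.
    move/eqP; rewrite eq_complex /= => /andP[/eqP E1 /eqP E2].
    apply/eqP; rewrite eq_complex /=.
    have h2n : logRx r x != 0 by rewrite gt_eqF.
    have w2n : w2 != 0 by rewrite gt_eqF.
    apply/andP; split; apply/eqP.
      apply: (@mulfI _ w2^-1); first by rewrite invr_eq0.
      move: E1; rewrite !mul0r !subr0 => /eqP; rewrite addr_eq0 => /eqP ->.
      by field; rewrite h2n w2n p0.
    apply: (@mulfI _ w2^-1); first by rewrite invr_eq0.
    move: E2; rewrite !mul0r !addr0 => /eqP; rewrite addr_eq0 => /eqP ->.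
    by field; rewrite h2n w2n p0.
  have -> : Jdens p f x = - ((beta + p) / p) / logRx r x * cabs (f x) `^ p.
    rewrite /Jdens -(powR_sub2_sqr (cabs_ge0 _) p1) E cabs_sqr Re_conjM.
    by case: (f x) => a b /=; ring.
  rewrite /dens1 (_ : beta + 1 + p + 1 = beta + p + 1 + 1); last by ring.
  rewrite (gt0_powRD (beta + p + 1) 1 h2) powRr1 ?(ltW h2)// !invfM; ring.
have [C1 _ _ _ _] := @densities_Cc R k m r p alpha (beta + 1) r0 p1 f Hf.
rewrite rint_zextZ//.
have -> : (fun x => cabs (f x) `^ p / (enorm (lsubmx x) `^ (alpha + p) *
    logRx r x `^ (beta + p + 1 + 1))) = dens1 r p alpha (beta + 1) f.
  by apply/funext => x; rewrite /dens1; congr (_ / (_ * _ `^ _)); ring.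
(* The coefficients are - (beta + p) from the cross term and beta + p + 1 from the weight; their sum
   is 1 for every beta, including beta = - p. *)
move: (rint _) => I1 H; rewrite -[RHS]H; by field.
Qed.

(** * Elementary smooth functions *)

Section FlatFunctions.
Variable R : realType.

(* [flat 0] is Cauchy's flat function; the powers of [1/t] make the family closed under
   differentiation. *)
Definition flat (n : nat) (t : R) : R := if 0 < t then t^-1 ^+ n * expR (- t^-1) else 0.

Lemma flat_ge0 n t : 0 <= flat n t.
Proof.
rewrite /flat; case: ifP => // t0; rewrite mulr_ge0 ?expR_ge0// exprn_ge0//.
by rewrite invr_ge0 ltW.
Qed.

Lemma flat0_gt0 t : 0 < t -> 0 < flat 0 t.
Proof. by move=> t0; rewrite /flat t0 expr0 mul1r expR_gt0. Qed.

Lemma flat_le0 n t : t <= 0 -> flat n t = 0.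
Proof. by rewrite /flat leNgt => /negPf ->. Qed.

(** From exp(1/t) >= t^-(n + 2) / (n + 2)!. A quadratic bound is what the derivative at 0 needs. *)
Lemma flat_le n t : flat n t <= n.+2`!%:R * t ^+ 2.
Proof.
have f0 : (0 : R) < n.+2`!%:R by rewrite ltr0n fact_gt0.
rewrite /flat; case: ifP => t0; last by rewrite mulr_ge0 ?sqr_ge0// ltW.
have ti : 0 < t^-1 by rewrite invr_gt0.
have := @expR_ge1Dxn R t^-1 n.+1 (ltW ti).
rewrite expRN => H; rewrite ler_pdivrMr ?expR_gt0//.
apply: (@le_trans _ _ (n.+2`!%:R * t ^+ 2 * (t^-1 ^+ n.+2 / n.+2`!%:R))); last first.
  apply: ler_wpM2l; first by rewrite mulr_ge0 ?sqr_ge0// ltW.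
  by apply: le_trans H; rewrite lerDr.
rewrite -addn2 exprD; have tn : t != 0 by rewrite gt_eqF.
rewrite le_eqVlt; apply/orP; left; apply/eqP.
rewrite addn2; field; rewrite tn /=.
by rewrite gt_eqF.
Qed.

Lemma flat_derive n (t : R) : is_derive t 1 (flat n) (flat n.+2 t - n%:R * flat n.+1 t).
Proof.
have [t0|t0|t0] := ltgtP t 0.
- rewrite !flat_le0 ?(ltW t0)// mulr0 subr0.
  apply: (@near_eq_is_derive _ _ _ (cst 0) _ t 1 0).
  have : \forall s \near t, s < 0 by exact: lt_nbhsl.
  by apply: filterS => s s0; rewrite flat_le0// ltW.
- have tn : t != 0 by rewrite gt_eqF.
  have E : \forall s \near t, (fun s => s^-1 ^+ n * expR (- s^-1)) s = flat n s.
    have : \forall s \near t, 0 < s by exact: lt_nbhsr.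
    by apply: filterS => s s0; rewrite /flat s0.
  apply: near_eq_is_derive E _.
  have dV : is_derive t 1 (fun s : R => s^-1) (- t ^- 2).
    have := @is_deriveV R id t 1 1 tn _.
    by move=> H; apply: is_derive_eq; rewrite /GRing.scale /= mulr1.
  have dX : is_derive t 1 (fun s : R => s^-1 ^+ n) (n%:R * t^-1 ^+ n.-1 * - t ^- 2).
    have H := @is_deriveX R R (fun s : R => s^-1) n t 1 _ dV.
    by rewrite exprfctE in H; apply: is_derive_eq H _.
  have dE := @is_derive1_comp R (@expR R) (fun s => - s^-1) t _ _ (is_derive_expR _) (is_deriveN dV).
  have H := is_deriveM dX dE.
  apply: is_derive_eq H _; rewrite /flat t0 /GRing.scale /=.
  case: n {dX} => [|n] /=; first by rewrite mul0r !expr0; field.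
  by rewrite !exprS !exprVn; field; rewrite expf_neq0.
- rewrite t0 !flat_le0// mulr0 subr0.
  (* By [flat_le] the difference quotient at 0 is at most (n + 2)! |h|. *)
  have lim0 : h^-1 *: ((flat n \o shift (0 : R)) (h *: (1 : R)) - flat n 0) @[h --> 0^'] --> (0 : R).
    apply/cvgr0Pnorm_lt => e e0.
    have c0 : (n.+2`!%:R : R) * `|h| @[h --> (0 : R)^'] --> (0 : R).
      have ch : `|h| @[h --> (0 : R)^'] --> (0 : R).
        apply: cvg_within_filter.
        by have := @norm_continuous R R 0; rewrite /continuous_at normr0.
      by have H := cvgM (cvg_cst (n.+2`!%:R : R)) ch; rewrite mulr0 in H; exact: H.
    near=> h.
    have h0 : h != 0 by near: h; exact: nbhs_dnbhs_neq.
    apply: (@le_lt_trans _ _ `|n.+2`!%:R * `|h| |); last by near: h; exact: (cvgr0_norm_lt _ c0).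
    rewrite [flat n 0]flat_le0// subr0 /= /shift addr0 -[h *: 1]/(h * 1) mulr1.
    rewrite -[_ *: _]/(_ * _) normrM normfV ler_pdivrMl ?normr_gt0//.
    rewrite ger0_norm ?flat_ge0// (le_trans (flat_le _ _))//.
    rewrite [X in _ <= _ * X]ger0_norm; last by rewrite mulr_ge0.
    by rewrite [leRHS]mulrCA -normrM -expr2 ger0_norm ?sqr_ge0.
  apply: DeriveDef; first by apply/cvg_ex; exists 0.
  exact: cvg_lim.
Unshelve. all: by end_near. Qed.

Lemma flat_continuous n : continuous (flat n).
Proof.
move=> t; apply/differentiable_continuous/derivable1_diffP.
exact: (@ex_derive _ _ _ _ _ _ _ (flat_derive n t)).
Qed.

End FlatFunctions.

Section ElementarySmooth.
Variables (R : realType) (N : nat) (U : set 'rV[R]_N).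

(** A syntactic class stable under differentiation: iterated derivatives in arbitrary directions are
    then handled by one induction. Positivity is demanded only on [U], where the functions are
    used. *)
Inductive elem : ('rV[R]_N -> R) -> Prop :=
| elemC c : elem (fun _ => c)
| elemX j : elem (fun x => x ord0 j)
| elemD f g : elem f -> elem g -> elem (fun x => f x + g x)
| elemM f g : elem f -> elem g -> elem (fun x => f x * g x)
| elem_flat n f : elem f -> elem (fun x => flat n (f x))
| elem_ln f : elem f -> (forall x, U x -> 0 < f x) -> elem (fun x => ln (f x))
| elem_powR c f : elem f -> (forall x, U x -> 0 < f x) -> elem (fun x => f x `^ c).

Lemma elem_continuous f : elem f -> forall x, U x -> {for x, continuous f}.
Proof.
elim=> {f} [c|j|f g _ IHf _ IHg|f g _ IHf _ IHg|n f _ IHf|f _ IHf f0|c f _ IHf f0] x Ux.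
- exact: cst_continuous.
- exact: coord_continuous.
- exact: (continuousD (IHf x Ux) (IHg x Ux)).
- exact: (continuousM (IHf x Ux) (IHg x Ux)).
- by apply: (@continuous_comp _ _ _ f (flat n)); [exact: IHf|exact: flat_continuous].
- by apply: (@continuous_comp _ _ _ f (@ln R)); [exact: IHf|exact/continuous_ln/f0].
- apply: (@continuous_comp _ _ _ f (fun t : R => t `^ c)); first exact: IHf.
  apply/differentiable_continuous/derivable1_diffP.
  exact: (@ex_derive _ _ _ _ _ _ _ (is_derive1_powR c (f0 x Ux))).
Qed.

Lemma elem_derive v f : elem f ->
  exists2 g, elem g & forall x, U x -> is_derive x v f (g x).
Proof.
elim=> {f} [c|j|f g Ef [f' Ef' Df] Eg [g' Eg' Dg]|f g Ef [f' Ef' Df] Eg [g' Eg' Dg]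
  |n f Ef [f' Ef' Df]|f Ef [f' Ef' Df] f0|c f Ef [f' Ef' Df] f0].
- by exists (fun=> 0) => [|x _]; [exact: elemC|exact: is_derive_cst].
- by exists (fun=> v ord0 j) => [|x _]; [exact: elemC|exact: is_derive_coord].
- exists (fun x => f' x + g' x) => [|x Ux]; first exact: elemD.
  exact: (is_deriveD (Df x Ux) (Dg x Ux)).
- exists (fun x => f x * g' x + g x * f' x) => [|x Ux].
    by apply: elemD; exact: elemM.
  exact: (is_deriveM (Df x Ux) (Dg x Ux)).
- exists (fun x => (flat n.+2 (f x) + (- n%:R) * flat n.+1 (f x)) * f' x) => [|x Ux].
    apply: elemM => //; apply: elemD; first exact: elem_flat.
    by apply: elemM; [exact: elemC|exact: elem_flat].
  rewrite mulNr; apply: is_derive_comp_dir (Df x Ux); exact: flat_derive.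
(* The reciprocal is written as a power in order to remain in the class. *)
- exists (fun x => f x `^ (-1) * f' x) => [|x Ux].
    by apply: elemM => //; exact: elem_powR.
  rewrite powR_inv1 ?(ltW (f0 _ Ux))//.
  by apply: is_derive_comp_dir (Df x Ux); exact/is_derive1_ln/f0.
- exists (fun x => c * f x `^ (c - 1) * f' x) => [|x Ux].
    by apply: elemM => //; apply: elemM; [exact: elemC|exact: elem_powR].
  by apply: (@is_derive_comp_dir _ _ (fun t : R => t `^ c)) (Df x Ux); exact/is_derive1_powR/f0.
Qed.

Lemma elem_sum n (F : 'I_n -> 'rV[R]_N -> R) :
  (forall i, elem (F i)) -> elem (fun x => \sum_(i < n) F i x).
Proof.
elim: n F => [|n IH] F HF.
  by under [X in elem X]eq_fun do rewrite big_ord0; exact: elemC.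
by under [X in elem X]eq_fun do rewrite big_ord_recl; apply: elemD => //; exact: IH.
Qed.

Lemma elem_prod n (F : 'I_n -> 'rV[R]_N -> R) :
  (forall i, elem (F i)) -> elem (fun x => \prod_(i < n) F i x).
Proof.
elim: n F => [|n IH] F HF.
  by under [X in elem X]eq_fun do rewrite big_ord0; exact: elemC.
by under [X in elem X]eq_fun do rewrite big_ord_recl; apply: elemM => //; exact: IH.
Qed.

(** The induction carries the vanishing off [K] along: every iterated derivative is again the zero
    extension of an [elem] function that vanishes there. *)
Lemma elem_smooth (K : set 'rV[R]_N) f : open U -> compact K -> K `<=` U -> elem f ->
  (forall x, U x -> ~ K x -> f x = 0) -> smooth (zext U f).
Proof.
move=> oU cK KU Ef f0.
have H vs : exists g, [/\ elem g, forall x, U x -> ~ K x -> g x = 0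
    & iderive vs (zext U f) = zext U g].
  elim: vs => [|v vs [g [Eg g0 E]]] /=; first by exists f.
  have [g' Eg' Dg] := elem_derive v Eg.
  have [g'0 Dz] := is_derive_zext oU cK KU Dg g0.
  exists g'; split => //; apply/funext => x; rewrite E.
  exact: (@derive_val _ _ _ _ _ _ _ (Dz x)).
move=> vs; have [g [Eg g0 E]] := H vs; rewrite E; split.
  exact: (zext_Cc oU cK KU (elem_continuous Eg) g0).1.
move=> x v; have [g' Eg' Dg] := elem_derive v Eg.
have [g'0 Dz] := is_derive_zext oU cK KU Dg g0.
exact: (@ex_derive _ _ _ _ _ _ _ (Dz x)).
Qed.

End ElementarySmooth.

(** * A bump function *)

Section Bump.
Variable R : realType.
Local Notation mu := (@lebesgue_measure R).

(** The primitive is the integral from minus infinity; to the right of b it equals the total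
    integral, which is 0. *)
Lemma primitive_of_zero_mean (phi : R -> R) (a b : R) : Cc phi ->
  (forall t, t <= a -> phi t = 0) -> (forall t, b <= t -> phi t = 0) ->
  \int[mu]_t phi t = 0 ->
  exists Phi : R -> R, [/\ forall t : R, is_derive t 1 Phi (phi t),
    forall t, t <= a -> Phi t = 0 & forall t, b <= t -> Phi t = 0].
Proof.
move=> cphi pa pb I0.
pose Phi (x : R) := \int[mu]_(t in `]-oo, x]) phi t.
exists Phi; split => [t|t ta|t bt].
- have iphi u : mu.-integrable `]-oo, u] (EFin \o phi).
    by apply: integrableS (Cc_integrable cphi).
  have t1 : t < t + 1 by rewrite ltrDl.
  have [d1 d2] := @continuous_FTC1 R phi -oo%O t (t + 1) t1 (iphi _) (ltNyr t) (cphi.1 t).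
  by apply: DeriveDef; [exact: d1|rewrite -derive1E; exact: d2].
- rewrite /Phi (@eq_Rintegral _ _ _ _ _ (fun=> 0)).
    by rewrite /Rintegral integral0_eq.
  by move=> s; rewrite inE /= in_itv /= => st; apply: pa; exact: le_trans ta.
- rewrite /Phi Rintegral_mkcond -[RHS]I0; congr Rintegral; apply/funext => s.
  rewrite patchE; case: ifPn => //; rewrite notin_setE /= in_itv /= => /negP.
  by rewrite -ltNge => ts; rewrite pb// (le_trans bt)// ltW.
Qed.

Definition hump (t : R) := flat 0 t * flat 0 (1 - t).
Definition dhump (t : R) := flat 2 t * flat 0 (1 - t) - flat 0 t * flat 2 (1 - t).

Lemma hump_ge0 t : 0 <= hump t.
Proof. by rewrite mulr_ge0 ?flat_ge0. Qed.

Lemma hump_out t : ~ (0 < t < 1) -> hump t = 0 /\ dhump t = 0.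
Proof.
move=> H; rewrite /hump /dhump; have [t0|t0] := leP t 0.
  by rewrite !(flat_le0 _ t0) !mul0r subr0.
have t1 : 1 - t <= 0 by rewrite subr_le0 leNgt; apply/negP => t1; apply: H; rewrite t0.
by rewrite !(flat_le0 _ t1) !mulr0 subr0.
Qed.

Lemma hump_derive (t : R) : is_derive t 1 hump (dhump t).
Proof.
have H1 := flat_derive 0 t.
have H2 : is_derive t 1 (fun s : R => 1 - s) (-1).
  have H := is_deriveB (is_derive_cst (1 : R) t 1) (is_derive_id t (1 : R)).
  by apply: is_derive_eq H _; rewrite sub0r.
have H3 := @is_derive1_comp R (flat 0) (fun s => 1 - s) t _ _ (flat_derive 0 (1 - t)) H2.
have H := is_deriveM H1 H3; apply: is_derive_eq H _.
rewrite /dhump !mul0r !subr0 -[_ *: _ + _]/(_ * _ + _ * _) /=; ring.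
Qed.

Lemma dhump_continuous : continuous dhump.
Proof.
move=> t; have c1 n : {for t, continuous (fun s : R => flat n (1 - s))}.
  apply: (@continuous_comp _ _ _ (fun s : R => 1 - s) (flat n)); last exact: flat_continuous.
  exact: (continuousB (@cst_continuous _ _ (1 : R) t) (@cvg_id _ (nbhs t))).
apply: (@continuousB _ _ _ (fun t => flat 2 t * flat 0 (1 - t)) (fun t => flat 0 t * flat 2 (1 - t))).
  by apply: continuousM => //; exact: flat_continuous.
by apply: continuousM => //; exact: flat_continuous.
Qed.

Lemma hump_continuous : continuous hump.
Proof.
move=> t; apply/differentiable_continuous/derivable1_diffP.
exact: (@ex_derive _ _ _ _ _ _ _ (hump_derive t)).
Qed.

Lemma hump_powR_continuous (p : R) : 0 < p -> continuous (fun t => hump t `^ p).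
Proof.
move=> p0 t; apply: (@continuous_powR_ge0 R R hump) => //; last exact: hump_ge0.
exact: hump_continuous.
Qed.

Lemma dhump_powR_continuous (p : R) : 0 < p -> continuous (fun t => `|dhump t| `^ p).
Proof.
move=> p0 t; apply: (@continuous_powR_ge0 R R (fun t => `|dhump t|)) => //.
by apply: (@continuous_comp _ _ _ dhump Num.norm); [exact: dhump_continuous|exact: norm_continuous].
Qed.

(** The constant is the ratio of the integrals of |hump'|^p and hump^p, chosen to give the
    difference zero mean. A compactly supported primitive encodes this one-dimensional ratio in a
    form that the divergence theorem can transport to the cylinder. *)
Lemma hump_primitive (p : R) : 0 < p -> exists c : R, exists2 Phi : R -> R,
  0 <= c & (forall t : R, is_derive t 1 Phi (`|dhump t| `^ p - c * hump t `^ p)) /\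
           (forall t, ~ (0 < t < 1) -> Phi t = 0).
Proof.
move=> p0.
have pn : p != 0 by rewrite gt_eqF.
have out (t : R) : 1 < `|t| -> ~ (0 < t < 1).
  move=> t1 /andP[h1 h2]; move: t1; rewrite gtr0_norm//; lra.
have C1 : Cc (fun t => `|dhump t| `^ p).
  split; first exact: dhump_powR_continuous.
  by exists 1 => t /out/hump_out[_ ->]; rewrite normr0 powR0.
have C0 : Cc (fun t => hump t `^ p).
  split; first exact: hump_powR_continuous.
  by exists 1 => t /out/hump_out[-> _]; rewrite powR0.
pose J1 := \int[mu]_t (`|dhump t| `^ p); pose J0 := \int[mu]_t (hump t `^ p).
have J10 : 0 <= J1 by apply: Rintegral_ge0 => t _; exact: powR_ge0.
have J00 : 0 <= J0 by apply: Rintegral_ge0 => t _; exact: powR_ge0.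
have J0n : J0 != 0.
  apply/eqP => J; have := Rint_eq0 C0 (fun t => powR_ge0 _ _) J (2^-1).
  move/powR_eq0_eq0 => /eqP; rewrite gt_eqF// mulr_gt0// flat0_gt0//; lra.
exists (J1 / J0).
have CB : Cc (fun t => `|dhump t| `^ p - J1 / J0 * hump t `^ p).
  have := CcD C1 (CcZ (- (J1 / J0)) C0); congr Cc; apply/funext => t.
  by rewrite mulNr.
have z (t : R) : ~ (0 < t < 1) -> `|dhump t| `^ p - J1 / J0 * hump t `^ p = 0.
  by move=> /hump_out[-> ->]; rewrite normr0 powR0// mulr0 subr0.
have [||//|Phi [H1 H2 H3]] := @primitive_of_zero_mean _ 0 1 CB.
- by move=> t t0; apply: z; lra.
- by move=> t t0; apply: z; lra.
- rewrite RintegralB//; [|exact: Cc_integrable|exact/Cc_integrable/CcZ].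
  rewrite RintegralZl//; last exact: Cc_integrable.
  by rewrite -/J1 -/J0 divfK// subrr.
exists Phi; first by rewrite divr_ge0.
split=> // t H; have [t0|t0] := leP t 0; first exact: H2.
by apply: H3; rewrite leNgt; apply/negP => t1; apply: H; rewrite t0.
Qed.

End Bump.

(** * Sharpness of the constant *)

(** Whichever of v and s u is larger bounds u + v. A small s brings the first coefficient close to
    1, at the price of a large second one. *)
Lemma powRD_le (R : realType) (p u v s : R) : 0 < p -> 0 <= u -> 0 <= v -> 0 < s ->
  (u + v) `^ p <= (1 + s) `^ p * u `^ p + (1 + s^-1) `^ p * v `^ p.
Proof.
move=> p0 u0 v0 s0; have si : 0 < s^-1 by rewrite invr_gt0.
have mono (x y : R) : 0 <= x -> x <= y -> x `^ p <= y `^ p.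
  by move=> x0 xy; apply: ge0_ler_powR; rewrite ?nnegrE ?(ltW p0)//; exact: le_trans xy.
rewrite -!powRM ?addr_ge0 ?(ltW s0) ?(ltW si)//.
have [h|h] := leP v (s * u).
  apply: (@le_trans _ _ (((1 + s) * u) `^ p)); last by rewrite lerDl powR_ge0.
  by apply: mono; rewrite ?addr_ge0//; lra.
apply: (@le_trans _ _ (((1 + s^-1) * v) `^ p)); last by rewrite lerDr powR_ge0.
apply: mono; first by rewrite addr_ge0.
have : u <= s^-1 * v by rewrite ler_pdivlMl// ltW.
lra.
Qed.

Section Sharpness.
Variables (R : realType) (k m : nat) (r p alpha beta eps : R).
Hypotheses (k0 : (0 < k)%N) (r0 : 0 < r) (p1 : 1 < p) (eps0 : 0 < eps).
Local Notation V := 'rV[R]_(k + m).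
Local Notation Om := (@OmegaR R k m r).
Local Notation rho x := (enorm (lsubmx x : 'rV[R]_k)).
Local Notation L := (@logRx R k m r).
Local Notation e_ j := (delta_mx 0 (lshift m j) : V).
Local Notation A0 := ((beta + p) / p).
Implicit Types (x : V) (q : R -> R).

Let p_gt0 : 0 < p := lt_trans ltr01 p1.
Let p_neq0 : p != 0. Proof. by rewrite gt_eqF. Qed.

(** Stretched logarithmic variable: 0 < [sL x] < 1 means exp(-1/eps) < L < 1, a range that reaches L
    = 0 as eps tends to 0. *)
Definition sL x := eps * ln (L x) + 1.
Definition hcut x := \prod_(j < m) flat 0 (1 - x ord0 (rshift k j) ^+ 2).
Definition profile (t : R) := t `^ A0 * hump (eps * ln t + 1).
Definition dprofile (t : R) :=
  t `^ (A0 - 1) * (A0 * hump (eps * ln t + 1) + eps * dhump (eps * ln t + 1)).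
Definition Ftest x := profile (L x) * hcut x.
Definition ftest x : R[i] := (zext Om Ftest x)%:C%C.
(** The bounds on |x'| are exp(-1/eps) <= L <= 1 rewritten through |x'| = r exp(-L). *)
Definition Ktest : set V := [set x | r * expR (-1) <= rho x] `&`
  ([set x | rho x <= r * expR (- expR (- eps^-1))] `&` [set x | `|rsubmx x| <= 1]).

Lemma hcut_ge0 x : 0 <= hcut x.
Proof. by apply: prodr_ge0 => j _; exact: flat_ge0. Qed.

Lemma hcut_elem (U : set V) : elem U hcut.
Proof.
apply: elem_prod => j; apply: elem_flat.
rewrite (_ : (fun x => _) = (fun x : V => 1 + -1 * (x ord0 (rshift k j) * x ord0 (rshift k j)))).
  by do ?[exact: elemC|exact: elemX|apply: elemD|apply: elemM].
by apply/funext => x; rewrite mulN1r expr2.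
Qed.

Lemma hcut_continuous : continuous hcut.
Proof. by move=> x; exact: (elem_continuous (hcut_elem setT)). Qed.

Lemma hcut_powR_continuous : continuous (fun x => hcut x `^ p).
Proof.
move=> x; apply: (@continuous_powR_ge0 R V hcut) => //; last exact: hcut_ge0.
exact: hcut_continuous.
Qed.

Lemma hcut_line x (j : 'I_k) (t : R) : hcut (x + t *: e_ j) = hcut x.
Proof.
apply: eq_bigr => i _; rewrite !mxE eq_rlshift andbF mulr0 addr0//.
Qed.

Lemma is_derive_constant_line (G : V -> R) x (v : V) :
  (forall t, G (x + t *: v) = G x) -> is_derive x v G 0.
Proof.
move=> H; have x0 : x = x + (0 : R) *: v by rewrite scale0r addr0.
rewrite x0; apply/(is_derive_line G).
by rewrite (_ : (fun t => _) = cst (G x)); [exact: is_derive_cst|apply/funext].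
Qed.

Lemma Ktest_sub : Ktest `<=` Om.
Proof.
move=> x [/= h1 [h2 _]]; apply/andP; split.
  by apply: lt_le_trans h1; rewrite mulr_gt0// expR_gt0.
apply: le_lt_trans h2 _; rewrite -[ltRHS]mulr1 ltr_pM2l//.
by rewrite expR_lt1 oppr_lt0 expR_gt0.
Qed.

Lemma Ktest_compact : compact Ktest.
Proof.
apply: bounded_closed_compact.
  exists (Num.max r 1); split; first exact: num_real.
  move=> M MM x Kx; have M0 : 0 <= M by apply/ltW/(lt_trans _ MM); rewrite lt_max ltr01 orbT.
  have [_ h2] := Om_rho (Ktest_sub Kx); have [_ [_ h3]] := Kx.
  move: MM; rewrite gt_max => /andP[Mr M1].
  apply/(mx_norm_leP _ M0) => i j; rewrite ord1 -(splitK j) /=.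
  case: (fintype.split j) => j' /=.
    apply: (@le_trans _ _ (rho x)); last exact/ltW/(lt_trans h2).
    rewrite rhoE -sqrtr_sqr ler_wsqrtr// (bigD1 j')//= lerDl.
    by apply: sumr_ge0 => ? _; exact: sqr_ge0.
  apply: (@le_trans _ _ `|rsubmx x|); last exact: (le_trans h3 (ltW M1)).
  by have := coord_le_norm (rsubmx x) 0 j'; rewrite mxE.
have cr : continuous (fun x : V => `|rsubmx x|).
  move=> x; apply: (@continuous_comp _ _ _ (fun x : V => rsubmx x) Num.norm).
    by apply: differentiable_continuous; exact: differentiable_rsubmx.
  exact: norm_continuous.
apply: closedI; last apply: closedI.
- refine (@preimage_closed V R (fun x => rho x) [set t : R | r * expR (-1) <= t] _ (@closed_ge R _)).
  by move=> x _; exact: rho_continuous.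
- refine (@preimage_closed V R (fun x => rho x) [set t : R | t <= _] _ (@closed_le R _)).
  by move=> x _; exact: rho_continuous.
- refine (@preimage_closed V R (fun x => `|rsubmx x|) [set t : R | t <= 1] _ (@closed_le R _)).
  by move=> x _; exact: cr.
Qed.

Lemma sL_in x : Om x -> 0 < sL x < 1 -> expR (- eps^-1) < L x < 1.
Proof.
move=> Ox; have L0 := L_gt0 Ox; rewrite /sL => /andP[h1 h2].
have e1 : ln (L x) < 0 by rewrite -(pmulr_rlt0 _ eps0); lra.
have e2 : - eps^-1 < ln (L x).
  rewrite -(@ltr_pM2l _ eps)// mulrN mulfV ?gt_eqF//; lra.
rewrite -[X in _ < X < _](@lnK _ (L x)) ?posrE// ltr_expR e2 /=.
by rewrite expR_lt1.
Qed.

Lemma Ktest_out x : Om x -> ~ Ktest x -> ~ (0 < sL x < 1) \/ hcut x = 0.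
Proof.
move=> Ox Kx; have [sx|sx] := boolP (0 < sL x < 1); last by left; apply/negP.
right; have /andP[l1 l2] := sL_in Ox sx.
have [j Hj] : exists j : 'I_m, 1 < `|x ord0 (rshift k j)|.
  apply/not_existsP => H; apply: Kx; split; last split => /=.
  - by rewrite /= (rho_expL r0 Ox) ler_pM2l// ler_expR lerN2 ltW.
  - by rewrite (rho_expL r0 Ox) ler_pM2l// ler_expR lerN2 ltW.
  - apply/(mx_norm_leP _ ler01) => i j; rewrite ord1 mxE leNgt; apply/negP => h.
    exact: (H j).
rewrite /hcut (bigD1 j)//= flat_le0 ?mul0r// subr_le0.
by rewrite -real_normK ?num_real// -[X in X <= _](expr1n _ 2) lerXn2r ?nnegrE// ltW.
Qed.

Lemma sL_continuous x : Om x -> {for x, continuous sL}.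
Proof.
move=> Ox; apply: continuousD; last exact: cst_continuous.
apply: (@continuousZ_fun R V); apply: (@continuous_comp _ _ _ L (@ln R)).
  exact: L_continuous.
by apply: continuous_ln; exact: L_gt0.
Qed.

(** In polar coordinates t^(k - 1) dt / (t^k L) is, up to sign, dL / L = ds / eps with s = [sL]; for
    A = k the integral thus sees [q] only through its one-dimensional integral. The power [^ 1]
    keeps the weight in the form of [continuous_weight] and [weightE]. *)
Definition tau q (A : R) x := q (sL x) * hcut x `^ p / (rho x `^ A * L x `^ 1).

Lemma tau_Cc q A : continuous q -> (forall t, ~ (0 < t < 1) -> q t = 0) ->
  Cc (zext Om (tau q A)).
Proof.
move=> cq q0; apply: (zext_Cc (@Om_open R k m r) Ktest_compact Ktest_sub) => [x Ox|x Ox Kx].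
  apply: continuousM; last exact: continuous_weight.
  apply: continuousM; last exact: hcut_powR_continuous.
  by apply: (@continuous_comp _ _ _ sL q); [exact: sL_continuous|exact: cq].
rewrite /tau; have [/q0 ->|->] := Ktest_out Ox Kx; first by rewrite !mul0r.
by rewrite powR0// mulr0 mul0r.
Qed.

Lemma tau_ge0 q A x : (forall t, 0 <= q t) -> 0 <= tau q A x.
Proof. by move=> q0; rewrite divr_ge0 ?mulr_ge0 ?powR_ge0. Qed.

(** On the support 0 < L < 1, so |x'|^(B - A) = r^(B - A) exp(- (B - A) L) is bounded independently
    of [eps]. *)
Lemma tau_compare q A B : continuous q -> (forall t, ~ (0 < t < 1) -> q t = 0) ->
  (forall t, 0 <= q t) ->
  rint (zext Om (tau q A)) <=
    r `^ (B - A) * expR `|B - A| * rint (zext Om (tau q B)).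
Proof.
move=> cq q0 qge; rewrite -rintZ; last exact: tau_Cc.
apply: le_rint; [exact: tau_Cc|by apply: CcZ; exact: tau_Cc|move=> x].
rewrite /zext; case: asboolP => Ox; last by rewrite mulr0.
have [sx|/negP/q0 sx] := boolP (0 < sL x < 1); last first.
  by rewrite /tau sx !mul0r mulr0.
have [h1 _] := Om_rho Ox; have h2 := L_gt0 Ox; have /andP[_ l2] := sL_in Ox sx.
have -> : tau q A x = rho x `^ (B - A) * tau q B x.
  rewrite /tau (gt0_powRD _ _ h1) powRN; field.
  by rewrite !gt_eqF ?powR_gt0.
apply: ler_wpM2r; first exact: tau_ge0.
rewrite (powR_rho r0 _ Ox) ler_pM2l ?powR_gt0// ler_expR.
rewrite mulNr -mulrN; apply: le_trans (ler_norm _) _.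
rewrite normrM normrN (gtr0_norm h2) -[leRHS]mulr1; apply: ler_wpM2l => //.
exact: ltW.
Qed.

(** Apply [rint_radial] to hcut^p and r^-k exp(k t) Phi(eps ln t + 1). The cut-off does not depend
    on x', and differentiating the exponential cancels the term with factor k; what remains is - eps
    times [tau phi k]. *)
Lemma tau_zero_mean (Phi phi : R -> R) : continuous phi ->
  (forall t : R, is_derive t 1 Phi (phi t)) -> (forall t, ~ (0 < t < 1) -> phi t = 0) ->
  (forall t, ~ (0 < t < 1) -> Phi t = 0) ->
  rint (zext Om (tau phi k%:R)) = 0.
Proof.
move=> cphi dPhi phi0 Phi0.
pose w (t : R) := r `^ (- k%:R) * expR (k%:R * t).
pose F (t : R) := w t * Phi (eps * ln t + 1).
pose dF (t : R) := k%:R * w t * Phi (eps * ln t + 1) + w t * (phi (eps * ln t + 1) * (eps / t)).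
have dw (t : R) : is_derive t 1 w (k%:R * w t).
  have H : is_derive t 1 (fun t : R => k%:R * t) k%:R.
    by have := @is_deriveZ R R R id k%:R t 1 1 _; rewrite /GRing.scale /= mulr1; apply.
  have H1 := @is_derive1_comp R (@expR R) (fun t => k%:R * t) t _ _ (is_derive_expR _) H.
  have H2 := is_deriveZ (r `^ (- k%:R)) H1.
  by apply: is_derive_eq H2 _; rewrite -[_ *: _]/(_ * _) /w /=; ring.
have dl (t : R) : 0 < t -> is_derive t 1 (fun t : R => eps * ln t + 1) (eps / t).
  move=> t0; have H := is_deriveD (is_deriveZ eps (is_derive1_ln t0)) (is_derive_cst (1 : R) t 1).
  by apply: is_derive_eq H _; rewrite addr0.
have cw (t : R) : {for t, continuous w}.
  apply/differentiable_continuous/derivable1_diffP.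
  exact: (@ex_derive _ _ _ _ _ _ _ (dw t)).
have cl (t : R) : 0 < t -> {for t, continuous (fun t : R => eps * ln t + 1)}.
  move=> t0; apply/differentiable_continuous/derivable1_diffP.
  exact: (@ex_derive _ _ _ _ _ _ _ (dl t t0)).
have cPhi : continuous Phi.
  move=> t; apply/differentiable_continuous/derivable1_diffP.
  exact: (@ex_derive _ _ _ _ _ _ _ (dPhi t)).
have H : rint (zext Om (fun x =>
    (k%:R * (hcut x `^ p) + \sum_(j < k) x ord0 (lshift m j) * 0) * F (L x) -
      hcut x `^ p * dF (L x))) = 0.
  apply: (@rint_radial R k m r r0 Ktest (fun x => hcut x `^ p) (fun _ _ => 0) F dF
    Ktest_compact Ktest_sub).
  - by move=> x _; exact: hcut_powR_continuous.
  - by move=> j x _; exact: cst_continuous.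
  - by move=> j x _; apply: is_derive_constant_line => t; rewrite hcut_line.
  - move=> t t0; apply: (@continuousD _ _ _ (fun t => k%:R * w t * Phi (eps * ln t + 1))
      (fun t => w t * (phi (eps * ln t + 1) * (eps / t)))).
      apply: continuousM; first exact: continuousZ_fun.
      by apply: (@continuous_comp _ _ _ (fun t : R => eps * ln t + 1) Phi); [exact: cl|exact: cPhi].
    apply: continuousM; first exact: cw.
    apply: continuousM.
      by apply: (@continuous_comp _ _ _ (fun t : R => eps * ln t + 1) phi); [exact: cl|exact: cphi].
    by apply: continuousZ_fun; apply: inv_continuous; rewrite gt_eqF.
  - move=> t t0.
    have H2 := @is_derive1_comp R Phi (fun t => eps * ln t + 1) t _ _ (dPhi _) (dl t t0).
    have H3 := is_deriveM (dw t) H2; apply: is_derive_eq H3 _.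
    by rewrite -[_ *: _ + _]/(_ * _ + _ * _) /dF /=; ring.
  - move=> x Ox Kx; have [/Phi0 E|->] := Ktest_out Ox Kx; last by rewrite powR0// mul0r.
    by rewrite /F -/(sL x) E !mulr0.
have C := tau_Cc k%:R cphi phi0.
apply/eqP; rewrite -(@mulrI_eq0 _ (- eps)); last by apply/mulfI; rewrite oppr_eq0 gt_eqF.
rewrite -rint_zextZ// -[X in _ == X]H; apply/eqP; congr rint; apply/funext => x.
rewrite /zext; case: asboolP => // Ox; have h2 := L_gt0 Ox.
rewrite big1 => [|j _]; last by rewrite mulr0.
rewrite /tau (weightE r0 _ _ Ox) powR_inv1 ?(ltW h2)// /F /dF /w /sL; ring.
Qed.

Lemma profile_derive (t : R) : 0 < t -> is_derive t 1 profile (dprofile t).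
Proof.
move=> t0.
have dl : is_derive t 1 (fun t : R => eps * ln t + 1) (eps / t).
  have H := is_deriveD (is_deriveZ eps (is_derive1_ln t0)) (is_derive_cst (1 : R) t 1).
  by apply: is_derive_eq H _; rewrite addr0.
have H2 := @is_derive1_comp R (@hump R) (fun t => eps * ln t + 1) t _ _ (hump_derive _) dl.
have H3 := is_deriveM (is_derive1_powR A0 t0) H2; apply: is_derive_eq H3 _.
rewrite -[_ *: _ + _]/(_ * _ + _ * _) /dprofile /=.
have -> : t `^ A0 = t `^ (A0 - 1) * t.
  by rewrite -{3}[t]powRr1 ?(ltW t0)// -gt0_powRD// subrK.
by field; rewrite p_neq0 gt_eqF.
Qed.

Lemma Ftest_out x : Om x -> ~ Ktest x -> Ftest x = 0.
Proof.
move=> Ox Kx; rewrite /Ftest /profile -/(sL x).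
have [/hump_out[-> _]|->] := Ktest_out Ox Kx; last by rewrite mulr0.
by rewrite mulr0 mul0r.
Qed.

Lemma Ftest_derive x (j : 'I_k) : Om x ->
  is_derive x (e_ j) Ftest (dprofile (L x) * - (x ord0 (lshift m j) / rho x ^+ 2) * hcut x).
Proof.
move=> Ox.
have H1 := is_derive_comp_dir (profile_derive (L_gt0 Ox)) (L_derive r0 j Ox).
have H2 := @is_derive_constant_line hcut x (e_ j) (hcut_line x j).
have H := is_deriveM H1 H2; apply: is_derive_eq H _.
by rewrite -[_ *: _ + _]/(_ * _ + _ * _) /=; ring.
Qed.

Lemma ftest_C0inf : C0inf Om ftest.
Proof.
have oO := @Om_open R k m r.
split; last split.
(* L is rebuilt as ln r - (1/2) ln |x'|^2, starting from a polynomial, so that the constructors of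
   [elem] apply. *)
- pose u x := \sum_(j < k) x ord0 (lshift m j) * x ord0 (lshift m j).
  pose Lg x := ln r + (- 2^-1) * ln (u x).
  have uE x : u x = rho x ^+ 2 by rewrite rho_sqr; apply: eq_bigr => j _; rewrite expr2.
  have u0 x : Om x -> 0 < u x by move=> /Om_rho[h _]; rewrite uE exprn_gt0.
  have LgE x : Om x -> Lg x = L x.
    move=> /Om_rho[h _]; rewrite /Lg uE /logRx ln_div ?posrE// lnXn//.
    by set l := ln (enorm _); lra.
  have eu : elem Om u by apply: elem_sum => j; apply: elemM; exact: elemX.
  have eL : elem Om Lg.
    apply: elemD; first exact: elemC.
    by apply: elemM; [exact: elemC|exact: elem_ln].
  have Lg0 x : Om x -> 0 < Lg x by move=> Ox; rewrite LgE//; exact: L_gt0.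
  have es : elem Om (fun x => eps * ln (Lg x) + 1).
    apply: elemD; last exact: elemC.
    by apply: elemM; [exact: elemC|exact: elem_ln].
  pose FG x := (Lg x `^ A0 * (flat 0 (eps * ln (Lg x) + 1) *
    flat 0 (1 + -1 * (eps * ln (Lg x) + 1)))) * hcut x.
  have EF x : Om x -> Ftest x = FG x.
    by move=> Ox; rewrite /Ftest /FG LgE// /profile /hump mulN1r.
  rewrite (_ : (fun x => _) = zext Om FG); last first.
    by apply/funext => x; rewrite /= /zext; case: asboolP => // Ox; rewrite EF.
  apply: (elem_smooth oO Ktest_compact Ktest_sub); last first.
    by move=> x Ox Kx; rewrite -EF// Ftest_out.
  apply: elemM; last exact: hcut_elem.
  apply: elemM; first exact: elem_powR.
  apply: elemM; apply: elem_flat => //.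
  by apply: elemD; [exact: elemC|apply: elemM => //; exact: elemC].
- rewrite (_ : (fun x => _) = zext Om (fun=> 0)); last first.
    by apply/funext => x; rewrite /= /zext; case: asboolP.
  by apply: (elem_smooth oO Ktest_compact Ktest_sub) => //; exact: elemC.
- exists Ktest; split; first exact: Ktest_compact.
  split; first exact: Ktest_sub.
  move=> x Kx; rewrite /ftest /zext; case: asboolP => // Ox.
  by rewrite Ftest_out.
Qed.

Lemma cabs_real (a : R) : cabs a%:C%C = `|a|.
Proof. by rewrite /cabs /= expr0n /= addr0 sqrtr_sqr. Qed.

Lemma xgrad_ftest x : Om x -> xgrad ftest x = (- (dprofile (L x) * hcut x))%:C%C.
Proof.
move=> Ox; apply/eqP; rewrite eq_complex Re_xgrad Im_xgrad /=.
apply/andP; split; apply/eqP; last first.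
  by rewrite big1// => j _; rewrite derive_cst mulr0.
rewrite -[LHS]/(\sum_(j < k) x ord0 (lshift m j) * derive (zext Om Ftest) x (e_ j)).
rewrite -mulrN1 -(x_grad_L Ox) mulr_sumr; apply: eq_bigr => j _.
have [_ D] := is_derive_zext (@Om_open R k m r) Ktest_compact Ktest_sub
  (fun x Ox => @Ftest_derive x j Ox) Ftest_out.
by rewrite (@derive_val _ _ _ _ _ _ _ (D x)) zext_in//; ring.
Qed.

(** The power (beta + p) / p in [profile] is the one for which both Hardy densities keep exactly the
    factor 1/L, so that they are both of the form [tau] with the same weight. *)
Lemma dens1_ftest x : Om x ->
  dens1 r p alpha beta ftest x = tau (fun t => hump t `^ p) (alpha + p) x.
Proof.
move=> Ox; have [h1 _] := Om_rho Ox; have h2 := L_gt0 Ox.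
rewrite /dens1 /ftest zext_in// cabs_real /Ftest /profile -/(sL x).
have P0 : 0 <= L x `^ A0 * hump (sL x) by apply: mulr_ge0; [exact: powR_ge0|exact: hump_ge0].
rewrite ger0_norm; last by apply: mulr_ge0 => //; exact: hcut_ge0.
rewrite (powRM _ P0 (hcut_ge0 x)) (powRM _ (powR_ge0 _ _) (hump_ge0 _)) -powRrM divfK//.
rewrite /tau (gt0_powRD (beta + p) 1 h2); field.
by rewrite !gt_eqF ?powR_gt0.
Qed.

Lemma dens2_ftest x : Om x -> dens2 r p alpha beta ftest x =
  tau (fun t => `|A0 * hump t + eps * dhump t| `^ p) (alpha + p) x.
Proof.
move=> Ox; have [h1 _] := Om_rho Ox; have h2 := L_gt0 Ox.
rewrite /dens2 xgrad_ftest// cabs_real normrN /dprofile -/(sL x) !normrM.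
rewrite (ger0_norm (hcut_ge0 x)) (ger0_norm (powR_ge0 _ _)).
rewrite (powRM _ (mulr_ge0 (powR_ge0 _ _) (normr_ge0 _)) (hcut_ge0 x)).
rewrite (powRM _ (powR_ge0 _ _) (normr_ge0 _)) -powRrM mulrBl divfK// mul1r addrK.
rewrite /tau (gt0_powRD beta 1 h2); field.
by rewrite !gt_eqF ?powR_gt0.
Qed.

Lemma ftest_neq0 : ftest <> (fun _ => 0).
Proof.
(* At L = t the variable [sL] equals 1/2, the middle of the hump; the point is taken with x'' =
   0. *)
pose t := expR (- (2 * eps)^-1); pose j0 := Ordinal k0.
have e2 : 0 < (2 * eps)^-1 by rewrite invr_gt0 mulr_gt0.
have t0 : 0 < t by exact: expR_gt0.
pose x : V := row_mx ((r * expR (- t)) *: delta_mx 0 j0) 0.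
have rt0 : 0 < r * expR (- t) by rewrite mulr_gt0// expR_gt0.
have rx : rho x = r * expR (- t).
  rewrite row_mxKl /enorm (bigD1 j0)//= big1 => [|i ij].
    by rewrite addr0 !mxE !eqxx mulr1 sqrtr_sqr gtr0_norm.
  by rewrite !mxE (negPf ij) mulr0 expr0n.
have Ox : Om x.
  apply/andP; rewrite rx; split => //.
  by rewrite -[ltRHS]mulr1 ltr_pM2l// expR_lt1 oppr_lt0.
have Lx : L x = t.
  by rewrite /logRx rx invfM mulrA mulfV ?gt_eqF// mul1r -expRN opprK expRK.
move=> /(congr1 (fun g => g x)); rewrite /ftest zext_in// => /eqP.
rewrite eq_complex /= eqxx andbT; apply/negP; rewrite gt_eqF// mulr_gt0//.
  rewrite Lx /profile mulr_gt0 ?powR_gt0// /hump.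
  have -> : eps * ln t + 1 = 2^-1 by rewrite /t expRK; field; rewrite gt_eqF.
  by rewrite mulr_gt0// flat0_gt0//; lra.
apply: prodr_gt0 => j _; apply: flat0_gt0.
by rewrite (row_mxEr (n1 := k)) mxE expr0n /= subr0.
Qed.

End Sharpness.

Lemma hardy_constant_sharp (R : realType) (k m : nat) (r p alpha beta C : R) :
  (0 < k)%N -> 0 < r -> 1 < p -> beta != - p -> `|(beta + p) / p| `^ p < C ->
  exists2 f : 'rV[R]_(k + m) -> R[i], C0inf (@OmegaR R k m r) f &
    rint (zext (@OmegaR R k m r) (dens2 r p alpha beta f)) <
    C * rint (zext (@OmegaR R k m r) (dens1 r p alpha beta f)).
Proof.
move=> k0 r0 p1 bp cC; set A0 := (beta + p) / p; set c := `|A0| `^ p in cC *.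
have p0 : 0 < p by lra.
have pn : p != 0 by rewrite gt_eqF.
have A0n : A0 != 0 by rewrite mulf_neq0 ?invr_eq0// addr_eq0.
have c0 : 0 < c by rewrite powR_gt0// normr_gt0.
(* The gap between c and C is split in two: up to [C1] for the factor (1 + s)^p, the rest for the
   derivative of the cut-off. *)
pose C1 := (c + C) / 2.
have cC1 : 1 < C1 / c by rewrite ltr_pdivlMr// mul1r /C1; lra.
pose s := (C1 / c) `^ p^-1 - 1.
have s0 : 0 < s by rewrite subr_gt0; apply: powR_gt1 => //; rewrite invr_gt0.
have sE : (1 + s) `^ p * c = C1.
  rewrite /s addrCA subrr addr0 -powRrM mulVf// powRr1 ?divfK ?gt_eqF//.
  by apply/ltW/(lt_trans ltr01).
have [c' [Phi c'0 [dPhi Phi0]]] := hump_primitive p0.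
pose D := (1 + s^-1) `^ p.
pose a := alpha + p.
pose M := r `^ (k%:R - a) * expR `|k%:R - a|; pose M' := r `^ (a - k%:R) * expR `|a - k%:R|.
(* Collects the cost of the error term: D from [powRD_le], M to pass to the weight |x'|^-k, c' to
   replace |hump'|^p by hump^p, M' to return. None of these depends on eps, which is chosen next
   with eps^p Q < C - C1. *)
pose Q := D * M * c' * M'.
have M0 : 0 <= M by rewrite mulr_ge0 ?powR_ge0 ?expR_ge0.
have M'0 : 0 <= M' by rewrite mulr_ge0 ?powR_ge0 ?expR_ge0.
have Q0 : 0 <= Q by rewrite !mulr_ge0 ?powR_ge0.
have CC1 : 0 < C - C1 by rewrite /C1; lra.
have d0 : 0 < (C - C1) / (Q + 1) by rewrite divr_gt0//; lra.
pose eps := ((C - C1) / (Q + 1)) `^ p^-1.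
have eps0 : 0 < eps by exact: powR_gt0.
have epsp : eps `^ p = (C - C1) / (Q + 1) by rewrite -powRrM mulVf// powRr1 ?(ltW d0).
exists (ftest r p beta eps); first exact: ftest_C0inf.
pose q0 (t : R) := hump t `^ p; pose q1 (t : R) := `|dhump t| `^ p.
have cq0 : continuous q0 by exact: hump_powR_continuous.
have cq1 : continuous q1 by exact: dhump_powR_continuous.
have zq0 t : ~ (0 < t < 1) -> q0 t = 0 by move=> /hump_out[E _]; rewrite /q0 E powR0.
have zq1 t : ~ (0 < t < 1) -> q1 t = 0 by move=> /hump_out[_ E]; rewrite /q1 E normr0 powR0.
pose T q A := rint (zext (@OmegaR R k m r) (@tau R k m r p eps q A)).
have Cq0 A : Cc (zext (@OmegaR R k m r) (@tau R k m r p eps q0 A)) by exact: tau_Cc.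
have Cq1 A : Cc (zext (@OmegaR R k m r) (@tau R k m r p eps q1 A)) by exact: tau_Cc.
have TE : T q1 k%:R = c' * T q0 k%:R.
  have cphi : continuous (fun t => q1 t - c' * q0 t).
    move=> t; apply: (@continuousB _ _ _ q1 (fun t => c' * q0 t)); first exact: cq1.
    by apply: continuousZ_fun; exact: cq0.
  have zphi t : ~ (0 < t < 1) -> q1 t - c' * q0 t = 0.
    by move=> H; rewrite zq0// zq1// mulr0 subr0.
  have := @tau_zero_mean R k m r p eps r0 p1 eps0 Phi _ cphi dPhi zphi Phi0.
  rewrite (_ : tau _ _ _ _ _ = (fun x : 'rV[R]_(k + m) => @tau R k m r p eps q1 k%:R x +
     - c' * @tau R k m r p eps q0 k%:R x)); last by apply/funext => x; rewrite /tau; ring.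
  rewrite rint_zextD//; last exact: Cc_zextZ.
  by rewrite rint_zextZ// -/(T q1 k%:R) -/(T q0 k%:R); lra.
have [C1c C2c _ _ _] := densities_Cc alpha beta r0 p1 (@ftest_C0inf R k m r p beta eps r0 eps0).
have E1 : rint (zext (@OmegaR R k m r) (dens1 r p alpha beta (ftest r p beta eps))) = T q0 a.
  congr rint; apply/funext => x; rewrite /zext; case: asboolP => // Ox.
  exact: dens1_ftest.
(* Positivity turns the strict inequality between the coefficients into one between the
   integrals. *)
have I1 : 0 < T q0 a.
  rewrite lt_neqAle; apply/andP; split; last first.
    by apply: rint_ge0 => x; rewrite /zext; case: asboolP => // _; apply: tau_ge0 => t; exact: powR_ge0.
  apply/eqP => /esym; rewrite -E1 => /(dens1_eq0 r0 p1 (ftest_C0inf k m p beta r0 eps0)).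
  exact: ftest_neq0.
have key t : `|A0 * hump t + eps * dhump t| `^ p <= C1 * q0 t + D * eps `^ p * q1 t.
  have h0 := hump_ge0 t; have e0 := ltW eps0.
  have a0 : 0 <= `|A0| * hump t by rewrite mulr_ge0.
  have b0 : 0 <= eps * `|dhump t| by rewrite mulr_ge0.
  apply: (@le_trans _ _ ((`|A0| * hump t + eps * `|dhump t|) `^ p)).
    apply: ge0_ler_powR; rewrite ?nnegrE ?(ltW p0) ?addr_ge0//.
    apply: le_trans (ler_normD _ _) _.
    by rewrite (normrM A0) (normrM eps) (ger0_norm h0) (gtr0_norm eps0).
  apply: le_trans (powRD_le p0 a0 b0 s0) _.
  by rewrite (powRM _ (normr_ge0 _) h0) (powRM _ e0 (normr_ge0 _)) -sE -/D /q0 /q1 /c !mulrA.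
have I2 : rint (zext (@OmegaR R k m r) (dens2 r p alpha beta (ftest r p beta eps))) <=
    C1 * T q0 a + D * eps `^ p * T q1 a.
  rewrite -!rintZ// -rintD; [|exact: CcZ|exact: CcZ].
  apply: le_rint => //; first by apply: CcD; exact: CcZ.
  move=> x; rewrite /zext; case: asboolP => Ox; last by rewrite !mulr0 addr0.
  rewrite dens2_ftest//.
  have -> : C1 * tau r p eps q0 a x + D * eps `^ p * tau r p eps q1 a x =
      (C1 * q0 (sL r eps x) + D * eps `^ p * q1 (sL r eps x)) * hcut x `^ p /
      (enorm (lsubmx x) `^ a * logRx r x `^ 1) by rewrite /tau; ring.
  apply: ler_wpM2r; first by rewrite invr_ge0 mulr_ge0 ?powR_ge0.
  by apply: ler_wpM2r; [exact: powR_ge0|exact: key].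
have T1 : T q1 a <= M * T q1 k%:R.
  by apply: tau_compare => // t; exact: powR_ge0.
have T0 : T q0 k%:R <= M' * T q0 a.
  by apply: tau_compare => // t; exact: powR_ge0.
rewrite E1; apply: le_lt_trans I2 _.
have D0 : 0 <= D * eps `^ p by rewrite mulr_ge0 ?powR_ge0.
have : D * eps `^ p * T q1 a <= eps `^ p * Q * T q0 a.
  apply: le_trans (ler_wpM2l D0 T1) _; rewrite TE.
  have -> : eps `^ p * Q * T q0 a = D * eps `^ p * (M * (c' * (M' * T q0 a))) by rewrite /Q; ring.
  by do 3!apply: ler_wpM2l => //.
have : eps `^ p * Q < C - C1.
  rewrite epsp mulrAC ltr_pdivrMr ?ltr_pM2l//; lra.
rewrite -(ltr_pM2r I1); lra.
Qed.

(* n = k + m, x = (x', x'') with x' = lsubmx x in R^k, x'' = rsubmx x in R^m *)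
Theorem theorem4p1 (R : realType) (k m : nat) (r p alpha beta : R) :
  (1 <= k)%N -> 0 < r -> 1 < p ->
  let Om := @OmegaR R k m r in
  let L := @logRx R k m r in
  let c := `|(beta + p) / p| `^ p in
  let I1 f := integral_on Om (fun x =>
      (cabs (f x) `^ p / (enorm (lsubmx x) `^ (alpha + p) * L x `^ (beta + p + 1)))%:E) in
  let I2 f := integral_on Om (fun x =>
      (cabs (xgrad f x) `^ p / (enorm (lsubmx x) `^ (alpha + p) * L x `^ (beta + 1)))%:E) in
  let I3 f := integral_on Om (fun x =>
      (cabs (f x) `^ p / (enorm (lsubmx x) `^ (alpha + p) * L x `^ (beta + p)))%:E) in
  let I4 f := integral_on Om (fun x =>
      (Cp p (xi_fun r p alpha beta f x) (eta_fun r p alpha beta f x))%:E) in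
  (* (i) *)
  (0 <= (k%:R - alpha - p) * (beta + p) ->
     (forall f : 'rV[R]_(k + m) -> R[i], C0inf Om f -> (c%:E * I1 f <= I2 f)%E)
     /\ (beta != - p ->
         forall C : R, c < C ->
           exists f : 'rV[R]_(k + m) -> R[i], C0inf Om f /\ (I2 f < C%:E * I1 f)%E))
  /\
  (* (ii) *)
  (forall f : 'rV[R]_(k + m) -> R[i], C0inf Om f ->
     (c%:E * I1 f
      = I2 f
        - ((k%:R - alpha - p) * ((beta + p) / p) * `|(beta + p) / p| `^ (p - 2))%:E * I3 f
        - I4 f)%E)
  /\
  (* (iii) *)
  (k%:R = alpha + p -> 2 <= p ->
     forall f : 'rV[R]_(k + m) -> R[i], C0inf Om f ->
       (I4 f = 0%E ->
          (exists phi : 'rV[R]_k -> 'rV[R]_m -> R[i],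
             forall x, Om x ->
               f x = ((L x `^ ((beta + p) / p))%:C
                      * phi ((enorm (lsubmx x))^-1 *: lsubmx x) (rsubmx x))%C)
          /\ f = (fun _ => 0))
       /\ (f <> (fun _ => 0) -> (c%:E * I1 f < I2 f)%E)).
Proof.
move=> k1 r0 p1 Om L c I1 I2 I3 I4.
pose rI g := rint (zext Om g).
have E1 f : C0inf Om f -> I1 f = (rI (dens1 r p alpha beta f))%:E.
  by move=> Hf; have [C1 _ _ _ _] := densities_Cc alpha beta r0 p1 Hf; exact: integral_on_rint.
have E2 f : C0inf Om f -> I2 f = (rI (dens2 r p alpha beta f))%:E.
  by move=> Hf; have [_ C2 _ _ _] := densities_Cc alpha beta r0 p1 Hf; exact: integral_on_rint.
have E3 f : C0inf Om f -> I3 f = (rI (dens3 r p alpha beta f))%:E.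
  by move=> Hf; have [_ _ C3 _ _] := densities_Cc alpha beta r0 p1 Hf; exact: integral_on_rint.
have E4 f : C0inf Om f -> I4 f = (rI (dens4 r p alpha beta f))%:E.
  by move=> Hf; have [_ _ _ _ C4] := densities_Cc alpha beta r0 p1 Hf; exact: integral_on_rint.
have p0 : 0 < p by exact: lt_trans p1.
split; last split.
- move=> kb; split=> [f Hf|bp C cC].
    rewrite E1// E2// -EFinM lee_fin (identity_rint alpha beta r0 p1 Hf) -addrA gerDl.
    rewrite -opprD oppr_le0 addr_ge0//; last by apply: rint_ge0; exact: dens4_ge0.
    apply: mulr_ge0; last by apply: rint_ge0; exact: dens3_ge0.
    by rewrite mulr_ge0 ?powR_ge0// mulrA divr_ge0// ltW.
  have [f Hf Hlt] := hardy_constant_sharp m alpha k1 r0 p1 bp cC.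
  by exists f; split => //; rewrite E1// E2// -EFinM lte_fin.
- move=> f Hf; rewrite E1// E2// E3// E4// -!EFinM -!EFinB; congr EFin.
  exact: identity_rint.
- move=> kE _ f Hf.
  have f0 : I4 f = 0%E -> f = (fun _ => 0).
    by rewrite E4// => -[]; exact: dens4_eq0.
  split=> [/f0 fz|fn].
    (* Since f is already known to vanish, the zero function serves as phi. *)
    by split=> //; exists (fun _ _ => 0) => x _; rewrite fz mulr0.
  rewrite E1// E2// -EFinM lte_fin (identity_rint alpha beta r0 p1 Hf).
  rewrite kE (_ : alpha + p - alpha - p = 0) ?mul0r ?subr0; last by ring.
  rewrite gtrDl oppr_lt0 lt_neqAle; apply/andP; split.
    by apply/eqP => I0; apply/fn/f0; rewrite E4// /rI -I0.
  by apply: rint_ge0; exact: dens4_ge0.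
Qed.
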